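(* Let $f:X\to X$ be the one-sided full shift on $X=\{0,1\}^{\mathbb N}$. Then there exist a Lipschitz continuous potential $\Phi:X\to\mathbb R^2$ and a direction vector $\alpha\in S^1$ such that $\mathrm{rv}(GS(\alpha))=\{\mathrm{rv}(\mu):\mu\in GS(\alpha)\}$ is a non-trivial compact line segment.
   Context: $X$ is equipped with the standard metric $d(\xi,\eta)=2^{-\min\{n:\xi_n\ne\eta_n\}}$ for $\xi\neq\eta$ (and $d(\xi,\xi)=0$). $\mathcal M$ denotes the set of $f$-invariant Borel probability measures with the weak$^*$ topology. An equilibrium state of a continuous $\varphi:X\to\mathbb R$ is a $\mu\in\mathcal M$ maximizing $h_\nu(f)+\int\varphi\,d\nu$ over $\nu\in\mathcal M$ ($h_\nu(f)$ is measure-theoretic entropy); $ES(\varphi)$ is the set of these. A ground state of $\varphi$ is a $\mu\in\mathcal M$ for which there are an increasing sequence $t_n\to\infty$ and $\mu_{t_n}\in ES(t_n\varphi)$ with $\mu_{t_n}\to\mu$ weak$^*$. For $\Phi=(\phi_1,\phi_2)$, $\mathrm{rv}(\mu)=(\int\phi_1\,d\mu,\int\phi_2\,d\mu)$. For $\alpha\in S^1$ (direction vectors), $GS(\alpha)$ is the set of ground states of $\alpha\cdot\Phi=\alpha_1\phi_1+\alpha_2\phi_2$. A non-trivial line segment is one with two distinct endpoints. *)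

(* Defs.v *)
From HB Require Import structures.
From mathcomp Require Import all_boot all_order all_algebra.
From mathcomp Require Import all_classical all_reals all_analysis.
Set Implicit Arguments.
Unset Strict Implicit.
Unset Printing Implicit Defensive.
Import Order.TTheory GRing.Theory Num.Theory.
Import numFieldNormedType.Exports.
Local Open Scope classical_set_scope.
Local Open Scope ring_scope.

(* Kolmogorov-Sinai entropy of a self-map of a probability space *)
Section entropy.
Context (d : measure_display) (T : measurableType d) (R : realType).
Implicit Types (mu : probability T R) (f : T -> T).

Definition finite_partition (k : nat) (A : 'I_k -> set T) : Prop :=
  [/\ forall i, measurable (A i), trivIset [set: 'I_k] A &
      \bigcup_i A i = [set: T]].

(* The cell of A \/ f^-1 A \/ ... \/ f^-(n-1) A with itinerary w; empty cells
   are harmless since they contribute 0 * ln 0 = 0 to the entropy. *)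
Definition join_cell (k : nat) (A : 'I_k -> set T) f (n : nat)
    (w : {ffun 'I_n -> 'I_k}) : set T :=
  [set x | forall i : 'I_n, A (w i) (iter i f x)].

Definition join_entropy mu f (k : nat) (A : 'I_k -> set T) (n : nat) : R :=
  - \sum_(w : {ffun 'I_n -> 'I_k})
      fine (mu (join_cell A f w)) * ln (fine (mu (join_cell A f w))).

(* For f-invariant mu the sequence converges (by subadditivity), so that limn
   is a genuine limit; its value at n = 0 is irrelevant. *)
Definition partition_entropy mu f (k : nat) (A : 'I_k -> set T) : R :=
  limn (fun n : nat => n%:R^-1 * join_entropy mu f A n).

Definition measure_entropy mu f : \bar R :=
  ereal_sup [set h | exists (k : nat) (A : 'I_k -> set T),
    finite_partition A /\ h = (partition_entropy mu f A)%:E].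

Definition invariant_measure mu f : Prop :=
  forall A : set T, measurable A -> mu (f @^-1` A) = mu A.

End entropy.

Definition full_shift (x : cantor_space) : cantor_space := fun n => x n.+1.

(* Coordinates are numbered from 0; numbering them from 1 halves the metric. *)
Definition cantor_dist (R : realType) (x y : cantor_space) : R :=
  if pselect (exists n, x n != y n) is left neq_xy then 2 ^- ex_minn neq_xy
  else 0.

Lemma cantor_dist_lt (R : realType) (x y : cantor_space) (n : nat) :
  cantor_dist R x y < 2 ^- n <-> forall i, (i <= n)%N -> x i = y i.
Proof.
rewrite /cantor_dist; case: pselect => [neq_xy|eq_xy]; last first.
  split=> [_ i _|_]; last by rewrite invr_gt0 exprn_gt0.
  by apply/eqP; apply: contrapT => /negP xyi; apply: eq_xy; exists i.
case: ex_minnP => m xym min_m; rewrite ltf_pV2 ?posrE ?exprn_gt0//.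
rewrite ltr_eXn2l ?ltr1n//; split=> [nm i i_n|eq_xy].
  apply/eqP; apply: contraT => /min_m; rewrite leqNgt.
  by rewrite (leq_ltn_trans i_n nm).
by rewrite ltnNge; apply/negP => /eq_xy/eqP; rewrite (negbTE xym).
Qed.

(* cantor_space carries the product topology; cantor_dist induces it. *)
Lemma cantor_dist_nbhs (R : realType) (x : cantor_space)
    (A : set cantor_space) :
  nbhs x A <-> exists2 e : R, 0 < e & [set y | cantor_dist R x y < e] `<=` A.
Proof.
split.
  pose F := filter_from [set e : R | 0 < e]
    (fun e => [set y | cantor_dist R x y < e]).
  have FF : Filter F.
    apply: filter_from_filter; first by exists 1 => /=.
    move=> e1 e2 /= e10 e20; exists (Num.min e1 e2) => /=.
      by rewrite lt_min e10.
    by move=> y /=; rewrite lt_min => /andP[].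
  suff Fx : F --> x by move=> /Fx.
  apply/cvg_sup => i; apply/cvg_image.
    rewrite eqEsubset; split=> [? _ //|b _].
    by exists (fun=> b).
  move=> B /nbhs_singleton Bxi.
  exists ((fun y : cantor_space => y i) @^-1` B).
    exists (2 ^- i) => /=; first by rewrite invr_gt0 exprn_gt0.
    by move=> y /= /cantor_dist_lt/(_ i (leqnn i)) <-.
  by rewrite image_preimage// eqEsubset; split=> [? _ //|b _]; exists (fun=> b).
move=> [e e0 eA].
have [n ne] : exists n, 2 ^- n < e.
  have lt1 : `|2^-1 : R| < 1 by rewrite ger0_norm ?invf_lt1 ?ltr1n.
  have /cvgrPdist_lt/(_ e e0)[n _ /(_ n (leqnn n))] := cvg_expr lt1.
  rewrite sub0r normrN ger0_norm ?exprn_ge0// exprVn => ?.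
  by exists n.
apply: (@filterS _ (nbhs x) (nbhs_filter x)
    (fun y => forall i : 'I_n.+1, x i = y i)).
  move=> y xy; apply: eA => /=; apply: lt_trans ne.
  apply/cantor_dist_lt => i i_n.
  exact: (xy (Ordinal (i_n : (i < n.+1)%N))).
apply: (@filter_forall _ _ _ (nbhs x) (nbhs_filter x)) => i.
have := @proj_continuous nat (fun=> bool) i x [set x i].
by move=> /(_ (discrete_set1 _)); apply: (@filterS _ _ (nbhs_filter x)) => y /=.
Qed.

(* The norm of 'rV[R]_2 is the max norm; by equivalence of norms the condition
   is the same as for the Euclidean one. *)
Definition lipschitz_potential (R : realType)
    (Phi : cantor_space -> 'rV[R]_2) : Prop :=
  exists K : R, forall x y, `|Phi x - Phi y| <= K * cantor_dist R x y.

Notation borel_cantor := (g_sigma_algebraType (@open cantor_space)).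

Section ground_states.
Context (R : realType).
Implicit Types (mu nu : probability borel_cantor R) (phi : cantor_space -> R).

Definition invariant_probability : set (probability borel_cantor R) :=
  [set mu | invariant_measure mu (full_shift : borel_cantor -> borel_cantor)].

Definition free_energy phi mu : \bar R :=
  (measure_entropy mu (full_shift : borel_cantor -> borel_cantor) + (\int[mu]_x phi x)%R%:E)%E.

Definition equilibrium_states phi : set (probability borel_cantor R) :=
  [set mu | invariant_probability mu /\
    forall nu, invariant_probability nu ->
      (free_energy phi nu <= free_energy phi mu)%E].

(* sequential convergence in the coarsest topology for which all the maps
   mu |-> \int[mu] g, with g continuous, are continuous *)
Definition weak_star_cvg (mu_ : nat -> probability borel_cantor R) mu : Prop :=
  forall g : cantor_space -> R, continuous g ->
    \int[mu_ n]_x g x @[n --> \oo] --> \int[mu]_x g x.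

Definition ground_states phi : set (probability borel_cantor R) :=
  [set mu | invariant_probability mu /\
    exists (t : nat -> R) (mu_ : nat -> probability borel_cantor R),
      [/\ {homo t : m n / (m < n)%N >-> m < n},
          t n @[n --> \oo] --> +oo,
          forall n, equilibrium_states (fun x => t n * phi x) (mu_ n) &
          weak_star_cvg mu_ mu]].

Definition unit_circle : set 'rV[R]_2 :=
  [set alpha | \sum_i alpha ord0 i ^+ 2 = 1].

Definition dir_potential (alpha : 'rV[R]_2) (Phi : cantor_space -> 'rV[R]_2)
    (x : cantor_space) : R :=
  \sum_i alpha ord0 i * Phi x ord0 i.

Definition rotation_vector (Phi : cantor_space -> 'rV[R]_2) mu : 'rV[R]_2 :=
  \row_i \int[mu]_x Phi x ord0 i.

Definition line_segment (a b : 'rV[R]_2) : set 'rV[R]_2 :=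
  [set (1 - s) *: a + s *: b | s in `[0, 1]].

End ground_states.

(* Main.v *)
Require Import Defs.
From HB Require Import structures.
From mathcomp Require Import all_boot all_order all_algebra.
From mathcomp Require Import all_classical all_reals all_analysis.
From mathcomp Require Import measurable_realfun ring lra zify.
Import Order.TTheory GRing.Theory Num.Theory.
Import numFieldNormedType.Exports.
Local Open Scope classical_set_scope.
Local Open Scope ring_scope.

Set Implicit Arguments.
Unset Strict Implicit.
Unset Printing Implicit Defensive.

(* Let phi vanish at the points x with x_0 = x_1, and otherwise be minus a cost
   c(s, n) where s^n is the run of equal symbols that starts at x_1.  If
   0 < c(s, n) <= 2^(-n), up to a constant factor, then phi is Lipschitz, and
   t phi has an explicit equilibrium state: the alternating renewal process in
   which a run s^n has weight q^n exp(-t c(s, n)), where q = q(t) makes the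
   product of the two total weights equal to 1.  Its free energy is -ln q, and
   comparing an arbitrary invariant measure with it through Gibbs' inequality
   shows that no invariant measure has a larger one.

   As t grows, runs shorter than some N_s(t) become too expensive and longer
   ones become free.  The mean cycle length goes to infinity, so limits of these
   states are mixtures of the two fixed points, and if N_0(t) is much larger
   than N_1(t) then the symbol 0 has frequency almost 1.  The costs drop along
   super-exponentially sparse levels, alternately for the two symbols, so both
   frequencies come close to 1 at arbitrarily large t; they depend continuously
   on t, so every mixture of the two fixed points is a ground state.
   Conversely the integral of phi vanishes for each ground state, so the second
   coordinate, the frequency of the symbol 1, is all that remains. *)

(** * Cylinders of the Cantor space *)

(** Why a gap between the two thresholds tips the frequencies: put D = 1 - q. The symbol with the
    early threshold M has total weight of order 1/D, so the pressure equation leaves weight of order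
    D to the other one, whose runs are free only from length N on and weigh about q^N / D. Hence q^N
    is of order D^2, N D grows like 2 ln(1/D), and N is much larger than 1/D. Runs of the late
    symbol have mean length at least N/2, those of the early symbol at most a multiple of 1/D, so
    the early symbol has frequency of order 1/(N D). The gap M^4 <= N makes M D small, so that the
    early threshold is invisible at scale 1/D. Entropy is a supremum over all finite partitions, so
    the upper bound must deal with arbitrary measurable cells: they are guessed from blocks of
    symbols, and the rare wrong guesses are paid for in the comparison distribution. A ground state
    is a limit of arbitrary equilibrium states. The vanishing of its integral is therefore derived
    from a comparison of free energies at two temperatures and not from the explicit states. *)

Section cylinders.
Implicit Types (x y : cantor_space) (w : seq bool).

Definition cyl w : set cantor_space := [set x | mkseq x (size w) = w].

Lemma mkseq_shift x n : mkseq x n.+1 = x 0%N :: mkseq (full_shift x) n.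
Proof. by rewrite /mkseq /= (iotaDl 1 0) -map_comp. Qed.

Lemma mkseq_eqP x y n :
  mkseq x n = mkseq y n <-> forall i, (i < n)%N -> x i = y i.
Proof.
split=> [xy i i_n|xy].
  by rewrite -(nth_mkseq true x i_n) xy nth_mkseq.
by apply/eq_in_map => i; rewrite mem_iota => /andP[_]; exact: xy.
Qed.

Lemma iter_shift x n i : iter n full_shift x i = x (n + i)%N.
Proof. by elim: n i => // n IH i; rewrite iterS /full_shift IH addnS. Qed.

Lemma mkseq_iter_shift x n m k : (k + n <= m)%N ->
  take n (drop k (mkseq x m)) = mkseq (iter k full_shift x) n.
Proof.
move=> km; have szt : size (take n (drop k (mkseq x m))) = n.
  by rewrite size_takel// size_drop size_mkseq; lia.
apply: (@eq_from_nth _ true); first by rewrite szt size_mkseq.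
move=> i; rewrite szt => i_n; have ? : (k + i < m)%N by lia.
by rewrite nth_take// nth_drop !nth_mkseq ?iter_shift.
Qed.

Lemma take_mkseq x n m : (n <= m)%N -> take n (mkseq x m) = mkseq x n.
Proof. by move=> nm; have := @mkseq_iter_shift x n m 0; rewrite drop0; apply. Qed.

Lemma cyl_nil : cyl [::] = setT.
Proof. by rewrite eqEsubset; split. Qed.

Lemma full_shift_cyl w :
  full_shift @^-1` cyl w = cyl (false :: w) `|` cyl (true :: w).
Proof.
rewrite eqEsubset; split=> x; rewrite /cyl /= !mkseq_shift.
  by case: (x 0%N) => ->; [right|left].
by move=> [] [_ ->].
Qed.

(** Two words are comparable for the prefix order or disagree at some position. *)
Lemma cyl_setI w1 w2 :
  cyl w1 `&` cyl w2 = set0 \/ exists w, cyl w1 `&` cyl w2 = cyl w.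
Proof.
wlog le12 : w1 w2 / (size w1 <= size w2)%N.
  move=> H; case: (leqP (size w1) (size w2)) => [/H //|/ltnW/H].
  by rewrite setIC.
have [pre|npre] := eqVneq (take (size w1) w2) w1.
  right; exists w2; rewrite eqEsubset; split=> x; first by case.
  rewrite /cyl /= => x2; split=> //.
  by rewrite -(take_mkseq x le12) x2.
left; rewrite eqEsubset; split=> // x; rewrite /cyl /= => -[x1 x2].
by case/eqP: npre; rewrite -[RHS]x1 -x2 take_mkseq.
Qed.

Lemma cantor_nbhsP x (A : set cantor_space) :
  nbhs x A <-> exists n, forall y, mkseq y n = mkseq x n -> A y.
Proof.
split.
  pose F := filter_from setT (fun n => [set y : cantor_space | mkseq y n = mkseq x n]).
  have FF : Filter F.
    apply: filter_from_filter; first by exists 0%N.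
    move=> n1 n2 _ _; exists (maxn n1 n2) => // y /mkseq_eqP xy.
    by split; apply/mkseq_eqP => i i_n; apply: xy; rewrite leq_max i_n ?orbT.
  suff Fx : F --> x by move=> /Fx[n _ nA]; exists n.
  apply/cvg_sup => i; apply/cvg_image.
    by rewrite eqEsubset; split=> [? _ //|b _]; exists (fun=> b).
  move=> B /nbhs_singleton Bxi.
  exists ((fun y : cantor_space => y i) @^-1` B).
    by exists i.+1 => // y /= /mkseq_eqP/(_ i (ltnSn i)) ->.
  by rewrite image_preimage// eqEsubset; split=> [? _ //|b _]; exists (fun=> b).
move=> [n nA].
apply: (@filterS _ (nbhs x) (nbhs_filter x) (fun y => forall i : 'I_n, y i = x i)).
  by move=> y xy; apply: nA; apply/mkseq_eqP => i i_n; exact: (xy (Ordinal i_n)).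
apply: (@filter_forall _ _ _ (nbhs x) (nbhs_filter x)) => i.
have := @proj_continuous nat (fun=> bool) i x [set x i].
by move=> /(_ (discrete_set1 _)); apply: (@filterS _ _ (nbhs_filter x)) => y /=.
Qed.

Lemma cantor_openP (A : set cantor_space) :
  open A <-> forall x, A x -> exists n, forall y, mkseq y n = mkseq x n -> A y.
Proof.
split; first by move=> oA x Ax; apply/cantor_nbhsP; exact: open_nbhs_nbhs.
by move=> H; rewrite openE => x Ax; apply/cantor_nbhsP/H.
Qed.

Lemma open_mkseq n (P : seq bool -> Prop) :
  open [set x : cantor_space | P (mkseq x n)].
Proof. by apply/cantor_openP => x /= Px; exists n => y ->. Qed.

Lemma measurable_mkseq n (P : seq bool -> Prop) :
  measurable ([set x | P (mkseq x n)] : set borel_cantor).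
Proof. exact: sub_sigma_algebra (open_mkseq n P). Qed.

Lemma measurable_cyl w : measurable (cyl w : set borel_cantor).
Proof. exact: (measurable_mkseq (size w) (fun v => v = w)). Qed.

Definition cylinders : set (set cantor_space) :=
  [set A | A = set0 \/ exists w, A = cyl w].

Lemma open_bigcup_cyl (A : set cantor_space) :
  open A -> A = \bigcup_(w in [set w | cyl w `<=` A]) cyl w.
Proof.
move=> /cantor_openP oA; rewrite eqEsubset; split=> [x /oA[n nA]|x [w wA]];
  last exact: wA.
exists (mkseq x n); last by rewrite /cyl /= size_mkseq.
by move=> y; rewrite /cyl /= size_mkseq => /nA.
Qed.

(** There are countably many words, so an open set is a countable union of cylinders. Being stable
    under intersection, cylinders then determine a probability measure. *)
Lemma measurable_cylinders :
  @measurable _ borel_cantor = <<s cylinders >>.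
Proof.
rewrite eqEsubset; split; apply: smallest_sub.
- exact: smallest_sigma_algebra.
- move=> A oA; rewrite (open_bigcup_cyl oA) bigcup_mkcond.
  have := @countable_bigcupT_measurable _ (g_sigma_algebraType cylinders)
    (seq bool) (fun w => if w \in [set w | cyl w `<=` A] then cyl w else set0).
  apply => [|w]; first exact: countableP.
  by case: ifP => _; apply: sub_sigma_algebra; [right; exists w|left].
- exact: (@smallest_sigma_algebra _ setT open).
- by move=> A [->|[w ->]]; [exact: measurable0|exact: measurable_cyl].
Qed.

Lemma cylinders_setI : setI_closed cylinders.
Proof.
move=> A B [->|[w1 ->]]; first by rewrite set0I; left.
move=> [->|[w2 ->]]; first by rewrite setI0; left.
by case: (cyl_setI w1 w2) => [->|[w ->]]; [left|right; exists w].
Qed.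

Lemma measurable_fun_cylP d (T : measurableType d) (g : T -> borel_cantor) :
  (forall w, measurable (g @^-1` cyl w)) -> measurable_fun setT g.
Proof.
move=> gw; have mE := @measurability _ _ T borel_cantor setT g cylinders measurable_cylinders.
apply: mE.
move=> _ [A [->|[w ->]] <-]; rewrite setTI; last exact: gw.
by rewrite preimage_set0.
Qed.

Lemma measurable_shift :
  measurable_fun setT (full_shift : borel_cantor -> borel_cantor).
Proof.
apply: measurable_fun_cylP => w; rewrite full_shift_cyl.
by apply: measurableU; exact: measurable_cyl.
Qed.

Lemma measurable_iter_shift n :
  measurable_fun setT (iter n full_shift : borel_cantor -> borel_cantor).
Proof.
elim: n => [|n IH]; first exact: measurable_id.
exact: (measurableT_comp measurable_shift IH).
Qed.

Lemma continuous_measurable_cantor (R : realType) (g : cantor_space -> R) :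
  continuous g -> measurable_fun setT (g : borel_cantor -> R).
Proof.
move=> gc; apply: (measurability _ (@measurable_realfun.RGenOpens.measurableE R)) => _ [_ [a [b ->]] <-].
rewrite setTI; apply: sub_sigma_algebra; apply: open_comp => [x _|]; first exact: gc.
exact: interval_open.
Qed.

Lemma cyl_probability_ext (R : realType) (mu nu : probability borel_cantor R) :
  (forall w, mu (cyl w) = nu (cyl w)) ->
  forall A, measurable A -> mu A = nu A.
Proof.
move=> munu A mA.
have uE := @measure_unique _ R borel_cantor cylinders (fun=> setT)
  measurable_cylinders cylinders_setI _ _ mu nu.
apply: uE => //.
- by move=> _; right; exists [::]; rewrite cyl_nil.
- by rewrite bigcup_const.
- move=> B [->|[w ->]]; first by rewrite !(measure0 (T := borel_cantor)).
  exact: munu.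
- by move=> _; apply: (@le_lt_trans _ _ 1%E); rewrite ?ltry ?probability_le1.
Qed.

End cylinders.

(** * Measures with prescribed values on cylinders *)

(** [mnormalize] serves to give a measure of mass 1 the structure of a [probability]. *)
Lemma mnormalizeE d (T : measurableType d) (R : realType)
    (m : {measure set T -> \bar R}) (P : probability T R) :
  m setT = 1%E -> mnormalize m P = m.
Proof.
move=> m1; apply/funext => x.
by rewrite /mnormalize m1 onee_eq0/= invr1 mule1.
Qed.

Section coding.
Variables (R : realType) (p : seq bool -> R).
Hypothesis p0 : forall w, 0 <= p w.
Hypothesis p_nil : p [::] = 1.
Hypothesis p_rcons : forall w, p (rcons w false) + p (rcons w true) = p w.

(* Arithmetic coding: the reals in [0, 1) whose code starts with the word w form
   the interval of length [p w] with left end [coding_left (rev w)]; prefixes are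
   kept reversed because they grow at their end. *)
Fixpoint coding_left (v : seq bool) : R :=
  if v is b :: v' then
    coding_left v' + (if b then p (rcons (rev v') false) else 0)
  else 0.

Fixpoint coding_word (u : R) n : seq bool :=
  if n is m.+1 then
    let v := coding_word u m in
    (coding_left v + p (rcons (rev v) false) <= u) :: v
  else [::].

Definition coding (u : measurableTypeR R) : borel_cantor :=
  fun n => head false (coding_word u n.+1).

Lemma mkseq_coding u n : mkseq (coding u) n = rev (coding_word u n).
Proof.
elim: n => // n IH.
have -> : mkseq (coding u) n.+1 = rcons (mkseq (coding u) n) (coding u n).
  by rewrite /mkseq -addn1 iotaD map_cat -cats1.
by rewrite IH -rev_cons.
Qed.

(** Appending a symbol splits the current interval at [coding_left v + p (rcons (rev v) false)]; by
    [p_rcons] the two pieces fill it. *)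
Lemma coding_wordP u v : 0 <= u < 1 ->
  (coding_word u (size v) == v) =
  (coding_left v <= u < coding_left v + p (rev v)).
Proof.
move=> u01; elim: v => [|b v IH] /=; first by rewrite eqxx p_nil add0r u01.
rewrite eqseq_cons IH andbC; have [uv|] := boolP (_ <= u < _); last first.
  move=> /negbTE uv; symmetry; apply: contraFF uv; rewrite rev_cons => /andP[lu ul].
  have pf := p0 (rcons (rev v) false); have pt := p0 (rcons (rev v) true).
  have ps := p_rcons (rev v).
  by case: b lu ul => lu ul; apply/andP; split; lra.
have /eqP -> : coding_word u (size v) == v by rewrite IH.
have ps := p_rcons (rev v).
rewrite rev_cons -addrA; case/andP: uv => lu ul.
case: b; last by rewrite addr0 add0r lu ltNge; case: (_ <= u).
by rewrite ps ul andbT; case: (_ <= u).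
Qed.

Lemma coding_left_bounds v :
  0 <= coding_left v /\ coding_left v + p (rev v) <= 1.
Proof.
elim: v => [|b v [l0 l1]] /=; first by rewrite p_nil add0r.
have := p0 (rcons (rev v) false); have := p0 (rcons (rev v) true).
by have := p_rcons (rev v); rewrite rev_cons; case: b => *; split; lra.
Qed.

Lemma measurable_coding_word n v :
  measurable ([set u | coding_word u n = v] : set (measurableTypeR R)).
Proof.
elim: n v => [|n IH] [|b v] /=.
- by rewrite (_ : [set _ | _] = setT)// eqEsubset; split.
- by rewrite (_ : [set _ | _] = set0)// eqEsubset; split.
- by rewrite (_ : [set _ | _] = set0)// eqEsubset; split.
pose a := coding_left v + p (rcons (rev v) false).
have -> : [set u | (coding_left (coding_word u n)
      + p (rcons (rev (coding_word u n)) false) <= u) :: coding_word u n = b :: v]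
    = [set u | coding_word u n = v] `&` (if b then `[a, +oo[%classic else `]-oo, a[%classic).
  rewrite eqEsubset; split=> u /=.
    by move=> [<- ->]; split=> //; case: leP => /= ?; rewrite in_itv/= ?andbT.
  by move=> [->]; case: b; rewrite /= in_itv/= ?andbT => au;
    [rewrite au|rewrite leNgt au].
by apply: measurableI; [exact: IH|case: b; exact: measurable_itv].
Qed.

Lemma coding_cyl w : coding @^-1` cyl w = [set u | coding_word u (size w) = rev w].
Proof.
rewrite eqEsubset; split=> u; rewrite /cyl /= mkseq_coding => wE.
  by apply: (can_inj revK); rewrite revK.
by rewrite wE revK.
Qed.

Lemma measurable_coding : measurable_fun setT coding.
Proof.
apply: measurable_fun_cylP => w; rewrite coding_cyl.
exact: measurable_coding_word.
Qed.

HB.instance Definition _ := isMeasurableFun.Build _ _ _ _ _ measurable_coding.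

Let unit_restr := mrestr lebesgue_measure (measurable_itv `[(0 : R), 1[).

Let unit_restrT : unit_restr [set: measurableTypeR R] = 1%E.
Proof.
rewrite /unit_restr /mrestr; set B := _ `&` _.
have -> : B = `[(0 : R), 1[%classic := setTI _.
by rewrite lebesgue_measure_itv/= lte_fin ltr01 oppr0 adde0.
Qed.

Let unit_measure : probability (measurableTypeR R) R :=
  @mnormalize _ (measurableTypeR R) R unit_restr (dirac (0 : measurableTypeR R)).

Let unit_measureE A : unit_measure A = unit_restr A.
Proof.
exact: (congr1 (@^~ A) (@mnormalizeE _ (measurableTypeR R) R unit_restr
  (dirac (0 : measurableTypeR R)) unit_restrT)).
Qed.

(** Extension by transport: a uniform point of [0, 1) is sent through [coding], and the preimage of
    a cylinder is an interval of the prescribed length, empty when that length is 0. *)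
Lemma cyl_probability_exists :
  exists mu : probability borel_cantor R, forall w, mu (cyl w) = (p w)%:E.
Proof.
exists (distribution unit_measure (coding : {mfun _ >-> _})) => w.
rewrite /distribution /pushforward /=; set A := _ @^-1` _.
have -> : A = _ := coding_cyl w.
rewrite [LHS]unit_measureE /unit_restr /mrestr.
set l := coding_left (rev w).
have -> : [set u | coding_word u (size w) = rev w] `&` `[0, 1[%classic =
   `[l, l + p w[%classic.
  have [l0 l1] := coding_left_bounds (rev w).
  rewrite eqEsubset; split=> u /=; rewrite !in_itv/=.
    move=> [/eqP]; rewrite -(size_rev w) => uw u01.
    by move: uw; rewrite coding_wordP// revK.
  move=> /andP[lu ul]; have u01 : 0 <= u < 1.
    by rewrite (le_trans l0 lu) (lt_le_trans ul)// -[w]revK.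
  by split=> //; apply/eqP; rewrite -(size_rev w) coding_wordP// revK lu.
rewrite lebesgue_measure_itv/= lte_fin ltrDl -EFinB addrAC subrr add0r.
by have := p0 w; rewrite le_eqVlt => /predU1P[<-|->//]; rewrite ltxx.
Qed.

End coding.

(** * Integrals of bounded functions, Gibbs' inequality *)

Section bounded_measurable.
Context d (T : measurableType d) (R : realType).
Implicit Types (g h : T -> R).

(** Boundedness gives integrability under every probability measure at once, and survives
    composition with the shift. *)
Definition bmeas g := measurable_fun setT g /\ exists M, forall x, `|g x| <= M.

Lemma bmeas_cst c : bmeas (fun=> c).
Proof. by split; [exact: measurable_cst|exists `|c|]. Qed.

Lemma bmeasD g h : bmeas g -> bmeas h -> bmeas (fun x => g x + h x).
Proof.
move=> [mg [M gM]] [mh [N hN]]; split; first exact: measurable_funD.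
by exists (M + N) => x; rewrite (le_trans (ler_normD _ _))// lerD.
Qed.

Lemma bmeasZ c g : bmeas g -> bmeas (fun x => c * g x).
Proof.
move=> [mg [M gM]]; split; first by apply: measurable_funM.
by exists (`|c| * M) => x; rewrite normrM ler_wpM2l.
Qed.

Lemma bmeas_sum (I : Type) (r : seq I) (g : I -> T -> R) :
  (forall i, bmeas (g i)) -> bmeas (fun x => \sum_(i <- r) g i x).
Proof.
move=> gi; elim: r => [|i r IH].
  under eq_fun do rewrite big_nil; exact: bmeas_cst.
by under eq_fun do rewrite big_cons; exact: bmeasD.
Qed.

Lemma bmeas_indic (A : set T) : measurable A -> bmeas (\1_A).
Proof.
move=> mA; split; first exact: measurable_indic.
by exists 1 => x; rewrite indicE; case: (_ \in _); rewrite ?normr1 ?normr0.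
Qed.

Variable P : probability T R.

Lemma bmeas_integrable g : bmeas g -> P.-integrable setT (EFin \o g).
Proof.
move=> [mg [M gM]]; apply: measurable_bounded_integrable => //.
  by apply: le_lt_trans (ltry 1); exact: probability_le1.
by exists M; split; [exact: num_real|move=> N MN x _ /=; exact: le_trans (gM x) (ltW MN)].
Qed.

Lemma Rint_cst c : \int[P]_x c = c.
Proof. by rewrite Rintegral_cst//= probability_setT mulr1. Qed.

Lemma RintD g h : bmeas g -> bmeas h ->
  \int[P]_x (g x + h x) = \int[P]_x g x + \int[P]_x h x.
Proof. by move=> bg bh; rewrite RintegralD//; exact: bmeas_integrable. Qed.

Lemma RintZ c g : bmeas g -> \int[P]_x (c * g x) = c * \int[P]_x g x.
Proof. by move=> bg; rewrite RintegralZl//; exact: bmeas_integrable. Qed.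

Lemma Rint_le g h : bmeas g -> bmeas h -> (forall x, g x <= h x) ->
  \int[P]_x g x <= \int[P]_x h x.
Proof. by move=> bg bh gh; apply: le_Rintegral => //; exact: bmeas_integrable. Qed.

Lemma Rint_sum (I : Type) (r : seq I) (g : I -> T -> R) :
  (forall i, bmeas (g i)) ->
  \int[P]_x (\sum_(i <- r) g i x) = \sum_(i <- r) \int[P]_x g i x.
Proof.
move=> gi; elim: r => [|i r IH].
  by under eq_Rintegral do rewrite big_nil; rewrite Rint_cst big_nil.
under eq_Rintegral do rewrite big_cons.
by rewrite RintD ?IH ?big_cons//; exact: bmeas_sum.
Qed.

Lemma Rint_indic (A : set T) : measurable A -> \int[P]_x (\1_A x : R) = fine (P A).
Proof. by move=> mA; rewrite /Rintegral integral_indic// setIT. Qed.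

Lemma fineP_ge0 (A : set T) : 0 <= fine (P A).
Proof. exact: fine_ge0. Qed.

Lemma fine_probability_le (A B : set T) : measurable A -> measurable B ->
  A `<=` B -> fine (P A) <= fine (P B).
Proof.
move=> mA mB AB; apply: fine_le; rewrite ?fin_num_measure//.
by apply: le_measure => //; rewrite inE.
Qed.

Definition finmeas (I : finType) (Y : T -> I) :=
  forall i, measurable (Y @^-1` [set i]).

Lemma finmeas_indicE (I : finType) (Y : T -> I) (G : I -> R) x :
  G (Y x) = \sum_i G i * \1_(Y @^-1` [set i]) x.
Proof.
rewrite (bigD1 (Y x))//= big1 ?addr0 => [|i iY].
  by rewrite indicE mem_set ?mulr1.
by rewrite indicE memNset ?mulr0//= => /esym/eqP; rewrite (negbTE iY).
Qed.

Lemma bmeas_fin (I : finType) (Y : T -> I) (G : I -> R) :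
  finmeas Y -> bmeas (fun x => G (Y x)).
Proof.
move=> mY; under eq_fun do rewrite finmeas_indicE.
by apply: bmeas_sum => i; apply: bmeasZ; apply: bmeas_indic; exact: mY.
Qed.

Lemma Rint_fin (I : finType) (Y : T -> I) (G : I -> R) : finmeas Y ->
  \int[P]_x G (Y x) = \sum_i fine (P (Y @^-1` [set i])) * G i.
Proof.
move=> mY; under eq_Rintegral do rewrite finmeas_indicE.
rewrite Rint_sum => [|i]; last by apply/bmeasZ/bmeas_indic/mY.
apply: eq_bigr => i _; rewrite RintZ ?Rint_indic 1?mulrC//.
exact/bmeas_indic/mY.
Qed.

Lemma sum_fin (I : finType) (Y : T -> I) : finmeas Y ->
  \sum_i fine (P (Y @^-1` [set i])) = 1.
Proof.
move=> mY; rewrite -[RHS](Rint_cst 1) (Rint_fin (fun=> 1) mY).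
by under [RHS]eq_bigr do rewrite mulr1.
Qed.

(** Termwise [a - q <= a * (ln a - ln q)], which is [ln z <= z - 1] at [z = q / a]; the left-hand
    sides add up to something nonnegative. *)
Lemma gibbs_inequality (I : finType) (Y : T -> I) (q : I -> R) :
  finmeas Y -> (forall i, 0 < q i) -> \sum_i q i <= 1 ->
  - \sum_i fine (P (Y @^-1` [set i])) * ln (fine (P (Y @^-1` [set i])))
    <= \int[P]_x - ln (q (Y x)).
Proof.
move=> mY q0 q1; rewrite (Rint_fin (fun i => - ln (q i)) mY) -sumrN.
set a := fun i => fine (P (Y @^-1` [set i])).
rewrite -subr_ge0 -sumrB.
have le_term i : a i - q i <= a i * - ln (q i) - - (a i * ln (a i)).
  have [a0|a0] := eqVneq (a i) 0; first by rewrite a0 !mul0r; have := q0 i; lra.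
  have {}a0 : 0 < a i by rewrite lt_neqAle eq_sym a0 fineP_ge0.
  have := @le_ln1Dx R (q i / a i - 1).
  rewrite ltrBDr addNr divr_gt0// => /(_ isT).
  rewrite addrCA subrr addr0 ln_div ?posrE// => lnle.
  have -> : a i - q i = a i * (1 - q i / a i) by field; rewrite gt_eqF.
  by rewrite mulrN opprK -mulrN -mulrDr ler_wpM2l ?(ltW a0)//; lra.
apply: le_trans (ler_sum _ (fun i _ => le_term i)).
by rewrite sumrB subr_ge0 sum_fin.
Qed.

End bounded_measurable.

(** * Integrals under shift-invariant measures *)

Section shift_invariance.
Variable R : realType.
Implicit Types (g : borel_cantor -> R) (nu : probability borel_cantor R).

Lemma bmeas_shift n g : bmeas g -> bmeas (fun x : borel_cantor => g (iter n full_shift x)).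
Proof.
move=> [mg [M gM]]; split; last by exists M.
exact: (measurableT_comp mg (measurable_iter_shift n)).
Qed.

Lemma iter_shift_invariant nu n (A : set borel_cantor) :
  invariant_probability nu -> measurable A ->
  nu (iter n full_shift @^-1` A) = nu A.
Proof.
move=> inv mA; elim: n => // n IH.
rewrite -IH -(inv (iter n full_shift @^-1` A)).
  by congr (nu _); rewrite eqEsubset; split=> x /=; rewrite -iterS -iterSr.
by rewrite -[X in measurable X]setTI; exact: measurable_iter_shift.
Qed.

Lemma Rint_shift nu n g : invariant_probability nu -> bmeas g ->
  \int[nu]_x g (iter n full_shift (x : cantor_space)) = \int[nu]_x g x.
Proof.
move=> inv bg; have [mg _] := bg; rewrite /Rintegral; congr fine.
have := @integral_pushforward _ _ _ _ R _ (measurable_iter_shift n) nu setT (EFin \o g).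
rewrite preimage_setT => <- //.
- apply: eq_measure_integral; first exact: measurable_iter_shift.
  by move=> mf A mA _; exact: iter_shift_invariant.
- exact/measurable_EFinP.
- exact/bmeas_integrable/bmeas_shift.
Qed.

Definition word n x : n.-tuple bool := Tuple (introT eqP (size_mkseq x n)).

Lemma word_eq n x (v : n.-tuple bool) : word n x = v <-> mkseq x n = v.
Proof. by split=> [<-|xv]; [exact: erefl|exact: val_inj]. Qed.

Lemma finmeas_word n : finmeas (word n : borel_cantor -> _).
Proof.
move=> v; have -> : word n @^-1` [set v] = [set x | mkseq x n = v].
  by rewrite eqEsubset; split=> x /word_eq.
exact: (measurable_mkseq n (fun w => w = v)).
Qed.

Lemma word_cyl n (v : n.-tuple bool) : word n @^-1` [set v] = cyl v.
Proof.
by rewrite eqEsubset /cyl; split=> x /=; rewrite size_tuple => /word_eq.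
Qed.

Lemma bmeas_mkseq n (G : seq bool -> R) :
  bmeas ((fun x => G (mkseq x n)) : borel_cantor -> R).
Proof. exact: (bmeas_fin (fun v : n.-tuple bool => G v) (@finmeas_word n)). Qed.

End shift_invariance.

(** * Approximation of measurable sets by finite unions of cylinders *)

Section approximation.
Variables (R : realType) (nu : probability borel_cantor R).
Implicit Types A B C : set borel_cantor.

Let symdiff A B := (A `\` B) `|` (B `\` A).
Let m A := fine (nu A).

Let m_le A B : measurable A -> measurable B -> A `<=` B -> m A <= m B.
Proof. exact: fine_probability_le. Qed.

Let mU A B : measurable A -> measurable B -> m (A `|` B) <= m A + m B.
Proof.
move=> mA mB; rewrite /m -fineD ?fin_num_measure//; apply: fine_le.
- by rewrite fin_num_measure//; exact: measurableU.
- by rewrite fin_numD !fin_num_measure.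
- exact: measureU2.
Qed.

Let mD A B : measurable A -> measurable B -> measurable (symdiff A B).
Proof. by move=> ? ?; apply: measurableU; exact: measurableD. Qed.

(** In spite of its name a condition on the first [N] symbols, that is, a finite union of
    cylinders. *)
Let tail_cyl N (B : set (seq bool)) : set borel_cantor := [set x | B (mkseq x N)].

Let approximable A := forall e : R, 0 < e ->
  exists N (B : set (seq bool)), m (symdiff A (tail_cyl N B)) < e.

Let approximable_refine A e : 0 < e -> approximable A ->
  exists N, forall M, (N <= M)%N ->
    exists B : set (seq bool), m (symdiff A (tail_cyl M B)) < e.
Proof.
move=> e0 /(_ e e0)[N [B AB]]; exists N => M NM.
exists [set w | B (take N w)].
by congr (m (symdiff A _) < e): AB; rewrite eqEsubset /tail_cyl; split=> x /=;
  rewrite take_mkseq.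
Qed.

Let approximableC A : measurable A -> approximable A -> approximable (~` A).
Proof.
move=> mA appA e /appA[N [B AB]]; exists N, (~` B).
rewrite (_ : symdiff _ _ = symdiff A (tail_cyl N B))//.
have -> : tail_cyl N (~` B) = ~` tail_cyl N B by [].
by rewrite /symdiff !setDE !setCK setUC (setIC (~` A)) (setIC (~` _)).
Qed.

Let approximableU A1 A2 : measurable A1 -> measurable A2 ->
  approximable A1 -> approximable A2 -> approximable (A1 `|` A2).
Proof.
move=> mA1 mA2 app1 app2 e e0; have e20 : 0 < e / 2 by rewrite divr_gt0.
have [N1 H1] := approximable_refine e20 app1.
have [N2 H2] := approximable_refine e20 app2.
have [B1 AB1] := H1 _ (leq_maxl N1 N2); have [B2 AB2] := H2 _ (leq_maxr N1 N2).
exists (maxn N1 N2), (B1 `|` B2); rewrite [e]splitr.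
apply: le_lt_trans (ltrD AB1 AB2); apply: le_trans (mU _ _); last 2 first.
- by apply: mD => //; exact: measurable_mkseq.
- by apply: mD => //; exact: measurable_mkseq.
apply: m_le; first by apply: mD; [exact: measurableU|exact: measurable_mkseq].
  by apply: measurableU; apply: mD => //; exact: measurable_mkseq.
by rewrite /symdiff /tail_cyl => x /=; tauto.
Qed.

Let approximable0 : approximable set0.
Proof.
move=> e e0; exists 0%N, set0; rewrite (_ : symdiff _ _ = set0) /m ?measure0//.
by rewrite eqEsubset; split=> // x [[]|[]].
Qed.

(** Half of [e] pays for cutting the union off, by continuity from below, the other half for
    approximating the finite union. *)
Let approximable_bigcup (A : (set borel_cantor)^nat) :
  (forall n, measurable (A n)) -> (forall n, approximable (A n)) ->
  approximable (\bigcup_n A n).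
Proof.
move=> mA appA e e0; have e20 : 0 < e / 2 by rewrite divr_gt0.
pose U n := \big[setU/set0]_(i < n) A i.
have mUn n : measurable (U n) by apply: bigsetU_measurable.
have appU n : approximable (U n).
  rewrite /U; elim: n => [|n IH]; first by rewrite big_ord0; exact: approximable0.
  by rewrite big_ord_recr/=; apply: approximableU => //; exact: mUn.
have mbA : measurable (\bigcup_n A n) by exact: bigcupT_measurable.
have UA n : U n `<=` \bigcup_n A n by exact: bigsetU_bigcup.
have cvgU : m (U n) @[n --> \oo] --> m (\bigcup_n A n).
  have bU : \bigcup_n U n = \bigcup_n A n.
    rewrite eqEsubset; split=> [x [n _ /UA//]|x [n _ Ax]]; exists n.+1 => //.
    by rewrite /U big_ord_recr/=; right.
  have := @nondecreasing_cvg_mu _ _ _ nu U mUn; rewrite bU.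
  move=> /(_ mbA) /(_ _) cU; apply: fine_cvg; rewrite fineK ?fin_num_measure//.
  by apply: cU; apply/nondecreasing_seqP => n; rewrite /U big_ord_recr/=;
    apply/subsetPset; exact: subsetUl.
move/cvgrPdist_lt : cvgU => /(_ _ e20)[n _ /(_ n (leqnn n))] near_U.
have [N [B UB]] := appU n _ e20; exists N, B.
have diff_lt : m (\bigcup_n A n `\` U n) < e / 2.
  rewrite /m measureD//; last by apply: le_lt_trans (ltry 1); exact: probability_le1.
  rewrite setIC setIidl// fineB ?fin_num_measure//.
  exact: le_lt_trans (ler_norm _) near_U.
rewrite [e]splitr; apply: le_lt_trans (ltrD diff_lt UB).
have mB : measurable (tail_cyl N B) by exact: measurable_mkseq.
apply: le_trans (mU _ _); last 2 first.
- exact: measurableD.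
- exact: mD.
apply: m_le; [exact: mD|by apply: measurableU; [exact: measurableD|exact: mD]|].
move=> x; have := UA n x; rewrite /symdiff /=.
by case: (pselect (U n x)); tauto.
Qed.

(** The measurable approximable sets form a sigma-algebra that contains the cylinders. *)
Lemma approximable_measurable A : measurable A -> approximable A.
Proof.
move=> mA; suff sub : <<s cylinders >> `<=` [set A | measurable A /\ approximable A].
  by have /sub[] : <<s cylinders >> A by rewrite -measurable_cylinders.
apply: smallest_sub.
  split.
  - by split; [exact: measurable0|exact: approximable0].
  - move=> B [mB appB]; rewrite setTD; split; first exact: measurableC.
    exact: approximableC.
  - move=> B appB; split; first by apply: bigcupT_measurable => n; case: (appB n).
    by apply: approximable_bigcup => n; case: (appB n).
move=> _ [->|[w ->]].
  by split; [exact: measurable0|exact: approximable0].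
split; first exact: measurable_cyl.
move=> e e0; exists (size w), [set w].
rewrite (_ : symdiff _ _ = set0) /m ?measure0//.
by rewrite eqEsubset; split=> // x; rewrite /symdiff /tail_cyl /cyl /=; tauto.
Qed.

End approximation.

(** * Upper bound for the entropy of a partition *)

Lemma ln_prod (R : realType) (I : Type) (r : seq I) (F : I -> R) :
  (forall i, 0 < F i) -> ln (\prod_(i <- r) F i) = \sum_(i <- r) ln (F i).
Proof.
move=> F0; elim: r => [|i r IH]; first by rewrite !big_nil ln1.
by rewrite !big_cons lnM ?posrE ?IH// prodr_gt0.
Qed.

Section entropy_upper_bound.
Variables (R : realType) (nu : probability borel_cantor R).
Hypothesis inv : invariant_probability nu.
Let f : borel_cantor -> borel_cantor := full_shift.

Section itinerary.
Variables (k : nat) (A : 'I_k -> set borel_cantor).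
Hypothesis partA : finite_partition A.

Let ex_cell x : exists i, A i x.
Proof. by case: partA => _ _ cov; have : setT x by []; rewrite -cov => -[i _]; exists i. Qed.

Definition cell x : 'I_k := projT1 (cid (ex_cell x)).

Lemma cellP x i : A i x <-> cell x = i.
Proof.
rewrite /cell; case: cid => j Ajx /=; split=> [Aix|<-//].
by case: partA => _ /trivIsetP tA _; apply: contrapT => /eqP ji;
  have := tA j i I I ji; rewrite -subset0 => /(_ x); apply.
Qed.

Definition itinerary n x : {ffun 'I_n -> 'I_k} := [ffun i => cell (iter (i : 'I_n) f x)].

Lemma join_cellE n w : join_cell A f w = itinerary n @^-1` [set w].
Proof.
rewrite eqEsubset; split=> x /=.
  by move=> H; apply/ffunP => i; rewrite ffunE; apply/cellP/H.
by move=> <- i; apply/cellP; rewrite ffunE.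
Qed.

Lemma finmeas_itinerary n : finmeas (itinerary n).
Proof.
move=> w; rewrite -join_cellE.
have -> : join_cell A f w = \bigcap_(i in [set: 'I_n]) (iter i f @^-1` A (w i)).
  by rewrite eqEsubset; split=> x H i; [move=> _|]; exact: H.
apply: fin_bigcap_measurable; first exact: finite_finset.
move=> i _; rewrite -[X in measurable X]setTI; apply: measurable_iter_shift => //.
by case: partA.
Qed.

(** Each cell is approximated within [e / k]. The guess [g] names any cell whose approximation
    contains the point, so it fails only on one of the [k] symmetric differences. *)
Lemma approximate_cell (e : R) : 0 < e ->
  exists N (g : seq bool -> 'I_k),
    measurable [set x : borel_cantor | cell x <> g (mkseq x N)] /\
    fine (nu [set x : borel_cantor | cell x <> g (mkseq x N)]) <= e.
Proof.
move=> e0.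
have k0 : (0 < k)%N by case: (cell point) => i; exact: leq_ltn_trans.
have mA i : measurable (A i) by case: partA.
have ek : 0 < e / k%:R by rewrite divr_gt0 ?ltr0n.
have /choice[N /choice[B AB]] := fun i => approximable_measurable nu (mA i) ek.
pose M := \max_i N i.
pose g w := odflt (Ordinal k0) [pick i | `[< B i (take (N i) w) >]].
pose C i : set borel_cantor := [set x | B i (mkseq x (N i))].
pose D i := (A i `\` C i) `|` (C i `\` A i).
have mC i : measurable (C i) by exact: measurable_mkseq.
have mD i : measurable (D i) by apply: measurableU; exact: measurableD.
pose bad : set borel_cantor := [set x | cell x <> g (mkseq x M)].
have gE x : (forall i, ~ D i x) -> cell x = g (mkseq x M).
  move=> nD; have AC i : A i x <-> C i x.
    by split=> H; apply: contrapT => nH; apply: (nD i); [left|right].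
  rewrite /g; case: pickP => [i /asboolP|/(_ (cell x)) /asboolP nB].
    rewrite take_mkseq ?leq_bigmax// => Bi; apply/cellP/AC; exact: Bi.
  by case: nB; rewrite take_mkseq ?leq_bigmax//; apply/AC/cellP.
have mbad : measurable bad.
  have -> : bad = \bigcup_(i in [set: 'I_k]) (~` A i `&`
      [set x : borel_cantor | i = g (mkseq x M)]).
    rewrite eqEsubset; split=> x /=.
      move=> bx; exists (g (mkseq x M)) => //; split => // Ax; apply: bx.
      exact/cellP.
    by move=> [i _ [/= nA ix]] cx; apply: nA; apply/cellP; rewrite ix.
  apply: fin_bigcup_measurable; first exact: finite_finset.
  move=> i _; apply: measurableI; first exact: measurableC.
  exact: (measurable_mkseq M (fun w => i = g w)).
exists M, g; split=> //; rewrite -Rint_indic//.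
apply: (@le_trans _ _ (\int[nu]_x \sum_i \1_(D i) x)).
  apply: Rint_le; first exact: bmeas_indic.
    by apply: bmeas_sum => i; exact: bmeas_indic.
  move=> x; rewrite indicE; case: (boolP (x \in bad)) => [|_]; last first.
    by apply: sumr_ge0 => i _; rewrite indicE; case: (_ \in _).
  rewrite inE => bx; have [i Dix] : exists i, D i x.
    by apply: contrapT => nD; apply: bx; apply: gE => i Dx; apply: nD; exists i.
  rewrite (bigD1 i)//= indicE mem_set// lerDl; apply: sumr_ge0 => j _.
  by rewrite indicE; case: (_ \in _).
rewrite Rint_sum => [|i]; last exact: bmeas_indic.
apply: (@le_trans _ _ (\sum_(i < k) e / k%:R)); last first.
  by rewrite sumr_const card_ord -[leLHS]mulr_natr divfK// pnatr_eq0 -lt0n.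
by apply: ler_sum => i _; rewrite Rint_indic//; exact/ltW/AB.
Qed.

End itinerary.

Section gibbs_weights.
Variables (p : seq bool -> R) (psi : borel_cantor -> R) (C : R).
Hypothesis p0 : forall w, 0 < p w.
Hypothesis p_nil : p [::] = 1.
Hypothesis p_rcons : forall w, p (rcons w false) + p (rcons w true) = p w.
Hypothesis bpsi : bmeas psi.
Hypothesis p_lower : forall (x : borel_cantor) n,
  - ln (p (mkseq x n)) <= C + \sum_(i < n) psi (iter i f x).

Lemma sum_word_weight n : \sum_(v : n.-tuple bool) p v = 1.
Proof.
have [mu muE] := cyl_probability_exists (fun w => ltW (p0 w)) p_nil p_rcons.
rewrite -(sum_fin mu (@finmeas_word n)); apply: eq_bigr => v _.
by rewrite word_cyl muE.
Qed.

Variables (k : nat) (A : 'I_k -> set borel_cantor).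
Hypothesis partA : finite_partition A.

(* Gibbs' inequality against the distribution that draws a word [v] with weight
   [p v] and then, at each time, the cell guessed by [g] from a block of [v] with
   probability [1 - delta], and a uniformly random cell otherwise. *)
Lemma join_entropy_le (delta e : R) N (g : seq bool -> 'I_k) n :
  0 < delta -> delta < 1 ->
  measurable [set x : borel_cantor | cell partA x <> g (mkseq x N)] ->
  fine (nu [set x : borel_cantor | cell partA x <> g (mkseq x N)]) <= e ->
  join_entropy nu f A n <= C + (n + N)%:R * (\int[nu]_x psi x)
    + n%:R * (- ln (1 - delta) + - ln (delta / k%:R) * e).
Proof.
move=> d0 d1; set bad := [set x | _] => mbad bad_e.
have k0 : (0 < k)%N by case: (cell partA point) => i; exact: leq_ltn_trans.
have k0R : 0 < k%:R :> R by rewrite ltr0n.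
(* The probability of cell [a] when the guess is [b]; the uniform part keeps the price of a wrong
   guess finite. *)
pose K (a b : 'I_k) := (a == b)%:R * (1 - delta) + delta / k%:R.
have K0 a b : 0 < K a b.
  by rewrite /K ltr_wpDl ?divr_gt0// mulr_ge0// subr_ge0 ltW.
have K1 b : \sum_a K a b = 1.
  rewrite big_split/= sumr_const card_ord -[X in _ + X]mulr_natr divfK ?gt_eqF//.
  rewrite (bigD1 b)//= big1 => [|i /negbTE ->]; last by rewrite mul0r.
  by rewrite eqxx mul1r addr0 subrK.
pose block (v : seq bool) i := take N (drop i v).
pose q (v : (n + N).-tuple bool) (w : {ffun 'I_n -> 'I_k}) :=
  p v * \prod_(i < n) K (w i) (g (block v i)).
pose Q w := \sum_v q v w.
have q0 v w : 0 < q v w by rewrite mulr_gt0// prodr_gt0.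
have Q0 w : 0 < Q w.
  rewrite /Q (bigD1 [tuple of nseq _ true])//= ltr_pwDl// sumr_ge0// => v _.
  exact: ltW.
have Q1 : \sum_w Q w <= 1.
  rewrite /Q exchange_big/= -(sum_word_weight (n + N)) ler_sum// => v _.
  rewrite -mulr_sumr -(bigA_distr_bigA (fun (i : 'I_n) j => K j (g (block v i))))/=.
  by rewrite big1 ?mulr1 => // i _; exact: K1.
have L0 : 0 <= - ln (delta / k%:R).
  rewrite oppr_ge0 ln_le0// ler_pdivrMr// mul1r (le_trans (ltW d1))//.
  by rewrite ler1n.
have c0 : 0 <= - ln (1 - delta) by rewrite oppr_ge0 ln_le0//; lra.
(* An upper bound for the price of one cell, large only on [bad]. *)
pose kappa (x : borel_cantor) := - ln (1 - delta) + - ln (delta / k%:R) * \1_bad x.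
have bkappa : bmeas kappa.
  by apply: bmeasD; [exact: bmeas_cst|apply: bmeasZ; exact: bmeas_indic].
have K_kappa (x : borel_cantor) : - ln (K (cell partA x) (g (mkseq x N))) <= kappa x.
  rewrite /kappa indicE /K; case: (boolP (x \in bad)).
    rewrite inE => /eqP/negbTE ->; rewrite mul0r add0r mulr1; lra.
  rewrite notin_setE /bad /= => /contrapT <-; rewrite eqxx mul1r mulr0 addr0.
  rewrite lerN2 ler_ln ?posrE ?subr_gt0//; first by rewrite lerDl divr_ge0// ltW.
  by rewrite addr_gt0 ?subr_gt0// divr_gt0.
have Y_psi (x : borel_cantor) : - ln (Q (itinerary partA n x)) <=
    C + \sum_(i < n + N) psi (iter i f x) + \sum_(i < n) kappa (iter i f x).
  (* Of the mixture [Q] only the term of the word actually seen is kept. Words have length [n + N]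
     because the last guess looks [N] symbols ahead. *)
  apply: (@le_trans _ _ (- ln (q (word (n + N) x) (itinerary partA n x)))).
    rewrite lerN2 ler_ln ?posrE//.
    rewrite /Q (bigD1 (word (n + N) x))//= lerDl sumr_ge0// => v _; exact: ltW.
  rewrite /q lnM ?posrE ?prodr_gt0// opprD lerD//; first exact: p_lower.
  rewrite ln_prod// -sumrN ler_sum// => i _; rewrite ffunE /block/=.
  by rewrite mkseq_iter_shift; [exact: K_kappa|rewrite leq_add2r ltnW].
rewrite /join_entropy; under eq_bigr do rewrite (join_cellE partA).
apply: le_trans (gibbs_inequality nu (@finmeas_itinerary _ _ partA n) Q0 Q1) _.
have bS m (h : borel_cantor -> R) : bmeas h ->
    bmeas (fun x : borel_cantor => \sum_(i < m) h (iter i f x)).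
  by move=> bh; apply: bmeas_sum => i; exact: bmeas_shift.
have SE m (h : borel_cantor -> R) : bmeas h ->
    \int[nu]_x (\sum_(i < m) h (iter i f x)) = m%:R * \int[nu]_x h x.
  move=> bh; rewrite Rint_sum => [|i]; last exact: bmeas_shift.
  under eq_bigr do rewrite Rint_shift//.
  by rewrite sumr_const card_ord mulr_natl.
apply: le_trans (Rint_le _ _ _ Y_psi) _.
- exact: (bmeas_fin (fun w => - ln (Q w)) (@finmeas_itinerary _ _ partA n)).
- by apply: bmeasD; [apply: bmeasD; [exact: bmeas_cst|exact: bS]|exact: bS].
rewrite RintD; [|by apply: bmeasD; [exact: bmeas_cst|exact: bS]|exact: bS].
rewrite RintD; [|exact: bmeas_cst|exact: bS].
rewrite Rint_cst !SE// lerD2l ler_wpM2l//.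
rewrite RintD; [|exact: bmeas_cst|by apply: bmeasZ; exact: bmeas_indic].
rewrite Rint_cst lerD2l RintZ; last exact: bmeas_indic.
by rewrite Rint_indic// ler_wpM2l.
Qed.

(* [partition_entropy] is 0 when its defining sequence diverges, which is why the
   right-hand side is assumed nonnegative. *)
Lemma partition_entropy_le : 0 <= \int[nu]_x psi x ->
  partition_entropy nu f A <= \int[nu]_x psi x.
Proof.
move=> psi0; rewrite /partition_entropy; set h := fun n => _.
have [cvg_h|dvg_h] := pselect (cvgn h); last first.
  rewrite (_ : limn h = 0)//; apply: getPN => l hl; apply: dvg_h.
  by apply/cvg_ex; exists l.
have k0 : (0 < k)%N by case: (cell partA point) => i; exact: leq_ltn_trans.
apply/ler_addgt0Pr => eta eta0.
(* Makes [- ln (1 - delta)] equal to [eta / 2]. *)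
pose delta : R := 1 - expR (- (eta / 2)).
have e2 : 0 < eta / 2 by rewrite divr_gt0.
have d0 : 0 < delta by rewrite subr_gt0 expR_lt1 oppr_lt0.
have d1 : delta < 1 by rewrite ltrBlDr ltrDl expR_gt0.
have L0 : 0 <= - ln (delta / k%:R).
  rewrite oppr_ge0 ln_le0// ler_pdivrMr ?ltr0n// mul1r (le_trans (ltW d1))//.
  by rewrite ler1n.
(* With this error probability, wrong guesses cost at most [eta / 2] per symbol. *)
pose e := eta / 2 / (1 - ln (delta / k%:R)).
have e0 : 0 < e by rewrite divr_gt0//; lra.
have [N [g [mbad bad_e]]] := approximate_cell partA e0.
have h_le n : (0 < n)%N ->
    h n <= n%:R^-1 * (C + N%:R * \int[nu]_x psi x) + (\int[nu]_x psi x + eta).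
  move=> n0; have n0R : 0 < n%:R :> R by rewrite ltr0n.
  rewrite /h ler_pdivrMl//; apply: le_trans (join_entropy_le n d0 d1 mbad bad_e) _.
  rewrite [leRHS]mulrDr mulVKf ?gt_eqF// natrD.
  rewrite [leLHS](_ : _ = C + N%:R * \int[nu]_x psi x + n%:R * (\int[nu]_x psi x
    + (- ln (1 - delta) + - ln (delta / k%:R) * e))); last by ring.
  rewrite [X in ln X](_ : 1 - delta = expR (- (eta / 2))); last by rewrite /delta; lra.
  rewrite expRK opprK.
  have : - ln (delta / k%:R) * e <= eta / 2.
    rewrite /e mulrA ler_pdivrMr; last by lra.
    by rewrite mulrC ler_wpM2l ?(ltW e2)//; lra.
  set Le := _ * e => le_Le.
  have : n%:R * (eta / 2 + Le) <= n%:R * eta by rewrite ler_wpM2l//; lra.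
  by rewrite mulrDr; lra.
have cvg_rhs : n%:R^-1 * (C + N%:R * \int[nu]_x psi x) + (\int[nu]_x psi x + eta)
    @[n --> \oo] --> 0 * (C + N%:R * \int[nu]_x psi x) + (\int[nu]_x psi x + eta).
  apply: cvgD; last exact: cvg_cst.
  apply: cvgM; last exact: cvg_cst.
  by have := @cvg_harmonic R; rewrite -(cvg_shiftS (fun n => n%:R^-1 : R)).
rewrite mul0r add0r in cvg_rhs.
rewrite -(cvg_lim _ cvg_rhs)//; apply: ler_lim => //.
  by apply/cvg_ex; eexists; exact: cvg_rhs.
by near=> n; apply: h_le; near: n; exists 1%N.
Unshelve. all: by end_near. Qed.

End gibbs_weights.
End entropy_upper_bound.

(** * Entropy of a measure with the Gibbs property *)

Section gibbs_measures.
Variables (R : realType) (p : seq bool -> R) (psi : borel_cantor -> R) (C : R).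
Hypothesis p0 : forall w, 0 < p w.
Hypothesis p_nil : p [::] = 1.
Hypothesis p_rcons : forall w, p (rcons w false) + p (rcons w true) = p w.
Hypothesis p_cons : forall w, p (false :: w) + p (true :: w) = p w.
Hypothesis bpsi : bmeas psi.
Hypothesis p_gibbs : forall (x : borel_cantor) n,
  `| - ln (p (mkseq x n)) - \sum_(i < n) psi (iter i full_shift x)| <= C.

Lemma measure_entropy_le (nu : probability borel_cantor R) :
  invariant_probability nu -> 0 <= \int[nu]_x psi x ->
  (measure_entropy nu (full_shift : borel_cantor -> borel_cantor)
    <= (\int[nu]_x psi x)%:E)%E.
Proof.
move=> inv psi0; apply: ge_ereal_sup => _ [k [A [partA ->]]]; rewrite lee_fin.
apply: (partition_entropy_le inv p0 p_nil p_rcons bpsi _ partA psi0 (C := C)).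
by move=> x n; rewrite -lerBlDr (le_trans (ler_norm _)).
Qed.

Variable mu : probability borel_cantor R.
Hypothesis muE : forall w, mu (cyl w) = (p w)%:E.

(** [p_cons] is invariance on cylinders, and cylinders determine the measure. *)
Lemma gibbs_invariant : invariant_probability mu.
Proof.
move=> A mA.
pose X : {mfun borel_cantor >-> borel_cantor} :=
  HB.pack (full_shift : borel_cantor -> borel_cantor)
    (isMeasurableFun.Build _ _ _ _ _ measurable_shift).
apply: (@cyl_probability_ext R (distribution mu X) mu) => // w.
rewrite [LHS](_ : _ = mu (cyl (false :: w) `|` cyl (true :: w))); last first.
  by rewrite -full_shift_cyl.
transitivity (mu (cyl (false :: w)) + mu (cyl (true :: w)))%E; last first.
  by rewrite !muE -EFinD p_cons.
apply: measureU; [exact: measurable_cyl|exact: measurable_cyl|].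
by rewrite -subset0 => x; rewrite /cyl /= !mkseq_shift => -[] [->].
Qed.

Definition coordinate_partition (i : 'I_2) : set borel_cantor :=
  [set x : cantor_space | x 0%N = (i == 1 :> nat)].

Lemma coordinate_partitionP : finite_partition coordinate_partition.
Proof.
split.
- move=> i; rewrite (_ : coordinate_partition i = cyl [:: i == 1 :> nat]).
    exact: measurable_cyl.
  rewrite eqEsubset /cyl /coordinate_partition /mkseq /=.
  by split=> x /=; [move=> ->|case].
- apply/trivIsetP => i j _ _ ij; rewrite -subset0 => x [].
  rewrite /coordinate_partition /= => + e; rewrite e => {}e; case/eqP: ij; apply/val_inj; move: e.
  by case: i j => -[|[|//]] ? [] [|[|//]].
- rewrite eqEsubset; split=> // x _.
  by case x0 : (x 0%N); [exists 1|exists 0].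
Qed.

(** The joins of this partition are the cylinders, so its join entropy is the integral of [- ln p],
    which stays within [C] of [n] times the integral of [psi]. *)
Lemma gibbs_partition_entropy :
  partition_entropy mu full_shift coordinate_partition = \int[mu]_x psi x.
Proof.
have inv := gibbs_invariant.
pose Y n := itinerary coordinate_partitionP n.
have YE n (x y : borel_cantor) : Y n y = Y n x <-> mkseq y n = mkseq x n.
  have cell0 z : z 0%N = (cell coordinate_partitionP z == 1 :> nat).
    exact: (iffRL (cellP coordinate_partitionP z _) erefl).
  rewrite mkseq_eqP; split=> [/ffunP xy i i_n|xy].
    have := xy (Ordinal i_n); rewrite !ffunE => xyi.
    by rewrite -[i]addn0 -!iter_shift !cell0 xyi.
  apply/ffunP => i; rewrite !ffunE; apply/cellP.
  by rewrite /coordinate_partition /= -cell0 !iter_shift addn0 xy.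
have HE n : join_entropy mu full_shift coordinate_partition n =
    \int[mu]_x - ln (p (mkseq x n)).
  pose Q w := fine (mu (Y n @^-1` [set w])).
  rewrite /join_entropy; under eq_bigr do rewrite (join_cellE coordinate_partitionP).
  rewrite -sumrN; transitivity (\int[mu]_x - ln (Q (Y n x))).
    rewrite (Rint_fin mu (fun w => - ln (Q w)) (@finmeas_itinerary _ _ coordinate_partitionP n)).
    by apply: eq_bigr => w _; rewrite mulrN.
  apply: eq_Rintegral => x _; rewrite /Q.
  rewrite (_ : Y n @^-1` [set Y n x] = cyl (mkseq x n)) ?muE//.
  by rewrite eqEsubset /cyl; split=> y /=; rewrite size_mkseq => /YE.
have bS n : bmeas (fun x : borel_cantor => \sum_(i < n) psi (iter i full_shift x)).
  by apply: bmeas_sum => i; exact: bmeas_shift.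
have bP n : bmeas ((fun x => - ln (p (mkseq x n))) : borel_cantor -> R).
  exact: (bmeas_mkseq n (fun w => - ln (p w))).
have SE n : \int[mu]_x (\sum_(i < n) psi (iter i full_shift (x : cantor_space))) =
    n%:R * \int[mu]_x psi x.
  rewrite Rint_sum => [|i]; last exact: bmeas_shift.
  under eq_bigr do rewrite Rint_shift//.
  by rewrite sumr_const card_ord mulr_natl.
have H_le n : `|join_entropy mu full_shift coordinate_partition n
    - n%:R * \int[mu]_x psi x| <= C.
  have int_C c : \int[mu]_x (\sum_(i < n) psi (iter i full_shift (x : cantor_space)) + c)
      = n%:R * \int[mu]_x psi x + c.
    by rewrite RintD ?SE ?Rint_cst//; exact: bmeas_cst.
  have bSC c : bmeas (fun x : borel_cantor =>
      \sum_(i < n) psi (iter i full_shift x) + c).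
    by apply: bmeasD => //; exact: bmeas_cst.
  have lo : n%:R * \int[mu]_x psi x + - C <= \int[mu]_x - ln (p (mkseq x n)).
    rewrite -int_C; apply: Rint_le => // x.
    by have := p_gibbs x n; rewrite ler_norml; lra.
  have up : \int[mu]_x - ln (p (mkseq x n)) <= n%:R * \int[mu]_x psi x + C.
    rewrite -int_C; apply: Rint_le => // x.
    by have := p_gibbs x n; rewrite ler_norml; lra.
  by rewrite HE ler_norml; lra.
apply/cvg_lim => //; apply/cvgrPdist_le => e e0.
near=> n; have n0 : 0 < n%:R :> R by rewrite ltr0n; near: n; exists 1%N.
have -> : \int[mu]_x psi x - n%:R^-1 * join_entropy mu full_shift coordinate_partition n
    = - (n%:R^-1 * (join_entropy mu full_shift coordinate_partition n
      - n%:R * \int[mu]_x psi x)) by field; rewrite gt_eqF.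
rewrite normrN normrM ger0_norm ?invr_ge0 ?(ltW n0)// ler_pdivrMl//.
apply: le_trans (H_le n) _; rewrite -ler_pdivrMr//.
by near: n; exact: nbhs_infty_ger.
Unshelve. all: by end_near. Qed.

Lemma gibbs_measure_entropy :
  ((\int[mu]_x psi x)%:E <=
    measure_entropy mu (full_shift : borel_cantor -> borel_cantor))%E.
Proof.
apply: ereal_sup_ubound; exists 2%N, coordinate_partition.
by split; [exact: coordinate_partitionP|rewrite gibbs_partition_entropy].
Qed.

End gibbs_measures.

(** * The potential and its renewal process *)

Section potential.
Variables (R : realType) (c : bool -> nat -> R).
Hypothesis c0 : forall s a, 0 <= c s a.
Hypothesis c2 : forall s a, c s a <= 2 ^- a.
Implicit Types x y z : cantor_space.

(* [c s a] is the cost of a run of [s] of length [a.+1], here the run that starts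
   s^a.+1 x; infinite runs are free. *)
Definition run_cost s a x : R :=
  if pselect (exists n, x n != s) is left neq_s then c s (a + ex_minn neq_s)
  else 0.

Definition renewal_potential x : R :=
  if x 0%N == x 1%N then 0
  else - run_cost (x 1%N) 0 (full_shift (full_shift x)).

Lemma run_cost_ge0 s a x : 0 <= run_cost s a x.
Proof. by rewrite /run_cost; case: pselect. Qed.

Lemma run_cost_le s a x : run_cost s a x <= 2 ^- a.
Proof.
rewrite /run_cost; case: pselect => [e|_]; last by rewrite invr_ge0 exprn_ge0.
apply: le_trans (c2 _ _) _; rewrite lef_pV2 ?posrE ?exprn_gt0//.
by rewrite ler_weXn2l ?ler1n// leq_addr.
Qed.

Lemma run_cost_same s a x :
  x 0%N = s -> run_cost s a x = run_cost s a.+1 (full_shift x).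
Proof.
move=> x0; rewrite /run_cost; case: pselect => [e|ne]; case: pselect => [e'|ne'] //.
- case: ex_minnP => m xm min_m; case: ex_minnP => m' xm' min_m'.
  congr (c s _); have := min_m _ xm'; case: m xm min_m => [|m xm _ le_m].
    by rewrite x0 eqxx.
  by have := min_m' _ xm; lia.
- exfalso; case: e => -[|n]; first by rewrite x0 eqxx.
  by move=> xn; case: ne'; exists n.
- by exfalso; case: e' => n xn; case: ne; exists n.+1.
Qed.

Lemma run_cost_diff s a x : x 0%N != s -> run_cost s a x = c s a.
Proof.
move=> x0; rewrite /run_cost; case: pselect => [e|[]]; last by exists 0%N.
by case: ex_minnP => -[|m] _ /(_ 0%N x0); rewrite ?addn0.
Qed.

(** Either both runs stop at the same place among the common symbols and cost the same, or both last
    through them and cost at most [2 ^- (a + m)]. *)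
Lemma run_cost_close m s a x y : (forall i, (i < m)%N -> x i = y i) ->
  `|run_cost s a x - run_cost s a y| <= 2 ^- (a + m).
Proof.
elim: m a x y => [|m IH] a x y xy.
  have := run_cost_ge0 s a x; have := run_cost_ge0 s a y.
  have := run_cost_le s a x; have := run_cost_le s a y.
  by rewrite addn0 ler_norml; lra.
have [xs|xs] := eqVneq (x 0%N) s.
  rewrite (run_cost_same a xs) (@run_cost_same s a y) -?xy// addnS -addSn.
  by apply: IH => i i_m; exact: xy.
by rewrite (run_cost_diff a xs) run_cost_diff -?xy// subrr normr0 invr_ge0 exprn_ge0.
Qed.

Lemma renewal_potential_le0 x : renewal_potential x <= 0.
Proof.
by rewrite /renewal_potential; case: eqP => // _; rewrite oppr_le0 run_cost_ge0.
Qed.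

Lemma renewal_potential_geN1 x : -1 <= renewal_potential x.
Proof.
rewrite /renewal_potential; case: eqP => _; first by rewrite lerN10.
by rewrite lerN2 (le_trans (run_cost_le _ _ _))// expr0 invr1.
Qed.

(** [run_cost] reads the sequence from its third symbol on, so two symbols of agreement are lost:
    hence the factor 4. *)
Lemma renewal_potential_close m x y : (forall i, (i < m)%N -> x i = y i) ->
  `|renewal_potential x - renewal_potential y| <= 4 * 2 ^- m.
Proof.
case: m => [|[|m]] xy.
- have := renewal_potential_le0 x; have := renewal_potential_geN1 x.
  have := renewal_potential_le0 y; have := renewal_potential_geN1 y.
  by rewrite expr0 invr1 ler_norml; lra.
- have := renewal_potential_le0 x; have := renewal_potential_geN1 x.
  have := renewal_potential_le0 y; have := renewal_potential_geN1 y.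
  by rewrite expr1 ler_norml; lra.
rewrite /renewal_potential -!xy//; case: eqP => _.
  by rewrite subrr normr0 mulr_ge0// invr_ge0 exprn_ge0.
have oppB (u v : R) : `|- u - - v| = `|u - v| by rewrite -normrN; congr `| _ |; ring.
rewrite oppB.
rewrite (_ : 4 * 2 ^- m.+2 = 2 ^- (0 + m)) ?run_cost_close//; last first.
  by rewrite add0n !exprS !invfM; field.
by move=> i i_m; rewrite /full_shift xy.
Qed.

Lemma cantor_dist_first_diff x y : x <> y -> exists2 m,
  cantor_dist R x y = 2 ^- m & forall i, (i < m)%N -> x i = y i.
Proof.
move=> xy; rewrite /cantor_dist; case: pselect => [e|ne]; last first.
  case: xy; apply/funext => i; apply: contrapT => /eqP xyi; apply: ne; exists i.
  exact: xyi.
case: ex_minnP => m _ min_m; exists m => // i im; apply/eqP; apply: contraLR im.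
by rewrite -leqNgt; exact: min_m.
Qed.

Lemma renewal_potential_lipschitz x y :
  `|renewal_potential x - renewal_potential y| <= 4 * cantor_dist R x y.
Proof.
have [<-|/cantor_dist_first_diff[m -> xy]] := pselect (x = y).
  rewrite subrr normr0 mulr_ge0// /cantor_dist; case: pselect => [e|_ //].
  by exfalso; case: e => n; rewrite eqxx.
exact: renewal_potential_close.
Qed.

Lemma renewal_potential_continuous : continuous renewal_potential.
Proof.
move=> x; apply/cvgrPdist_lt => e e0; apply/cantor_nbhsP.
have [m me] : exists m, 2 ^- m < e / 4.
  have e40 : 0 < e / 4 by rewrite divr_gt0.
  have lt1 : `|2^-1 : R| < 1 by rewrite ger0_norm ?invf_lt1 ?ltr1n.
  have /cvgrPdist_lt/(_ _ e40)[n _ /(_ n (leqnn n))] := cvg_expr lt1.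
  by rewrite sub0r normrN ger0_norm ?exprn_ge0// exprVn => ?; exists n.
exists m => y /esym/mkseq_eqP xy.
by apply: le_lt_trans (renewal_potential_close xy) _; lra.
Qed.

Lemma bmeas_renewal_potential : bmeas (renewal_potential : borel_cantor -> R).
Proof.
split; first exact: continuous_measurable_cantor renewal_potential_continuous.
exists 1 => x; rewrite ler_norml renewal_potential_geN1.
by rewrite (le_trans (renewal_potential_le0 x)).
Qed.

(* [tail s a] is the total weight of the runs of [s] of length at least [a.+1],
   and [tail2 s a] is the sum of [tail s k] over [k >= a]. *)
Section renewal_weights.
Variables (t q B : R) (tail tail2 : bool -> nat -> R).
Hypothesis t0 : 0 <= t.
Hypothesis q0 : 0 < q.
Let r s a := q ^+ a.+1 * expR (- (t * c s a)).
Hypothesis tailS : forall s a, tail s a = r s a + tail s a.+1.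
Hypothesis tail2S : forall s a, tail2 s a = tail s a + tail2 s a.+1.
Hypothesis tail_gt0 : forall s a, 0 < tail s a.
Hypothesis tail2_gt0 : forall s a, 0 < tail2 s a.
Hypothesis tail_log : forall s a, `|ln (tail s a) - a.+1%:R * ln q| <= B.
Hypothesis tail2_log : forall s a, `|ln (tail2 s a) - a.+1%:R * ln q| <= B.
Hypothesis tail_pressure : tail false 0 * tail true 0 = 1.

(** The sum of the tails counts each run with its length, so this is the mean length of a run of
    [s], and [Z] is that of a cycle. *)
Let mean s := tail2 s 0 / tail s 0.
Let Z := mean false + mean true.

(* The word [w] continues a run of [s] which has length [a.+1] so far. *)
Fixpoint renewal_weight s a (w : seq bool) : R :=
  if w is b :: w' then
    if b == s then renewal_weight s a.+1 w'
    else r s a / tail s 0 * renewal_weight b 0 w'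
  else tail s a / tail s 0.

(* Same, but that run may have begun before the observation. *)
Fixpoint stationary_weight s a (w : seq bool) : R :=
  if w is b :: w' then
    if b == s then stationary_weight s a.+1 w'
    else tail s a / (tail s 0 * Z) * renewal_weight b 0 w'
  else tail2 s a / (tail s 0 * Z).

Definition word_weight (w : seq bool) : R :=
  if w is b :: w' then stationary_weight b 0 w' else 1.

Let r_gt0 s a : 0 < r s a.
Proof. by rewrite mulr_gt0 ?exprn_gt0 ?expR_gt0. Qed.

Let Z_gt0 : 0 < Z.
Proof. by rewrite addr_gt0// divr_gt0. Qed.

Let FZ_gt0 s : 0 < tail s 0 * Z.
Proof. by rewrite mulr_gt0. Qed.

Lemma renewal_weight_gt0 s a w : 0 < renewal_weight s a w.
Proof.
elim: w s a => [|b w IH] s a /=; first by rewrite divr_gt0.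
by case: ifP => _ //; rewrite mulr_gt0// divr_gt0.
Qed.

Lemma stationary_weight_gt0 s a w : 0 < stationary_weight s a w.
Proof.
elim: w s a => [|b w IH] s a /=; first by rewrite divr_gt0.
by case: ifP => _ //; rewrite mulr_gt0 ?divr_gt0// renewal_weight_gt0.
Qed.

Lemma word_weight_gt0 w : 0 < word_weight w.
Proof. by case: w => //= b w; exact: stationary_weight_gt0. Qed.

Lemma renewal_weight_rcons s a w :
  renewal_weight s a (rcons w false) + renewal_weight s a (rcons w true)
    = renewal_weight s a w.
Proof.
elim: w s a => [|b w IH] s a /=.
  rewrite [in RHS]tailS; case: s; rewrite /= divff ?gt_eqF// mulr1 mulrDl//.
  by rewrite addrC.
by case: ifP => _; rewrite ?IH// -mulrDr IH.
Qed.

Lemma stationary_weight_rcons s a w :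
  stationary_weight s a (rcons w false) + stationary_weight s a (rcons w true)
    = stationary_weight s a w.
Proof.
elim: w s a => [|b w IH] s a /=.
  rewrite [in RHS]tail2S; case: s; rewrite /= divff ?gt_eqF// mulr1 mulrDl//.
  by rewrite addrC.
by case: ifP => _; rewrite ?IH// -mulrDr renewal_weight_rcons.
Qed.

Lemma word_weight_rcons w :
  word_weight (rcons w false) + word_weight (rcons w true) = word_weight w.
Proof.
case: w => [|b w] /=; last exact: stationary_weight_rcons.
by rewrite !invfM !mulrA -mulrDl -/(mean false) -/(mean true) -/Z divff ?gt_eqF.
Qed.

(** The symbol before the observed ones either belongs to the same run or is separated from it by a
    switch, and switches in a given direction have frequency [1 / Z]. This is what makes the process
    stationary. *)
Lemma stationary_weightS s a w :
  stationary_weight s a w = stationary_weight s a.+1 w + renewal_weight s a w / Z.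
Proof.
elim: w s a => [|b w IH] s a /=.
  by rewrite tail2S mulrDl addrC invfM !mulrA.
case: ifP => _; first exact: IH.
by rewrite tailS !mulrDl addrC invfM; congr (_ + _); ring.
Qed.

Lemma word_weight_cons w :
  word_weight (false :: w) + word_weight (true :: w) = word_weight w.
Proof.
case: w => [|b w]; first exact: (word_weight_rcons [::]).
have first_run s : tail s 0 / (tail s 0 * Z) = Z^-1.
  by rewrite invfM mulrA divff ?gt_eqF// mul1r.
rewrite [RHS]/= stationary_weightS.
by case: b => /=; rewrite first_run; [rewrite addrC|]; rewrite [Z^-1 * _]mulrC.
Qed.

Let psi x : R := - ln q - t * renewal_potential x.
(** Only the product of the two total weights is 1, so each division by [tail s 0] leaves an error.
    The errors cancel over a cycle; [lk] is the coboundary that absorbs them. *)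
Let lk (s : bool) : R := if s then ln (tail false 0) else 0.

Let lk_neg s b : b != s -> lk b = ln (tail s 0) + lk s.
Proof.
case: s b => -[] //= _; last by rewrite addr0.
by rewrite addrC -lnM ?posrE// tail_pressure ln1.
Qed.

Let sum_psiS x m : \sum_(i < m.+1) psi (iter i full_shift x) =
  psi x + \sum_(i < m) psi (iter i full_shift (full_shift x)).
Proof.
rewrite big_ord_recl/=; congr (_ + _); apply: eq_bigr => i _.
by rewrite -iterSr.
Qed.

Let CG := B + t + `|ln (tail false 0)| + `|ln (tail true 0)|.

(** The potential charges a run when it starts, the weight when it ends: [t * run_cost] is the
    charge of the current run, made before [z]. With this term and [lk] the left-hand side is
    unchanged by each step of the induction, so the bound does not grow with [m]. *)
Let renewal_weight_log m a z :
  `|ln (renewal_weight (z 0%N) a (mkseq (full_shift z) m))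
    + t * run_cost (z 0%N) a (full_shift z)
    + \sum_(i < m) psi (iter i full_shift z) - a.+1%:R * ln q - lk (z 0%N)|
  <= CG.
Proof.
elim: m a z => [|m IH] a z.
  rewrite big_ord0 addr0 [mkseq _ 0]/= [renewal_weight _ _ _]/= ln_div ?posrE//.
  have := tail_log (z 0%N) a; have := run_cost_ge0 (z 0%N) a (full_shift z).
  have : run_cost (z 0%N) a (full_shift z) <= 1.
    by rewrite (le_trans (run_cost_le _ _ _))// invf_le1 ?exprn_gt0// exprn_ege1// ler1n.
  move=> /(ler_wpM2l t0); rewrite mulr1 => le_t /(mulr_ge0 t0) ge_t.
  have := ler_norm (ln (tail false 0)); have := ler_norm (- ln (tail false 0)).
  have := ler_norm (ln (tail true 0)); have := ler_norm (- ln (tail true 0)).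
  move: le_t ge_t; rewrite /CG /lk !normrN !ler_norml.
  by case: (z 0%N); lra.
rewrite mkseq_shift sum_psiS [renewal_weight _ _ (_ :: _)]/=.
have z1 : full_shift z 0%N = z 1%N by [].
rewrite z1; have [zz|zz] := eqVneq (z 1%N) (z 0%N).
  have := IH a.+1 (full_shift z); rewrite z1 zz (run_cost_same _ (x := full_shift z))//.
  rewrite /psi {2}/renewal_potential zz eqxx mulr0 subr0.
  by congr (`| _ | <= _); rewrite -[a.+2]addn1 natrD; ring.
have := IH 0%N (full_shift z); rewrite z1.
rewrite (run_cost_diff _ (x := full_shift z)) ?z1// lnM ?posrE ?divr_gt0//; last first.
  exact: renewal_weight_gt0.
rewrite ln_div ?posrE// /r lnM ?posrE ?exprn_gt0 ?expR_gt0// lnXn// expRK.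
rewrite (lk_neg zz) /psi {2}/renewal_potential eq_sym (negbTE zz).
by congr (`| _ | <= _); rewrite -[ln q *+ _]mulr_natl; ring.
Qed.

Let CE := CG + CG + CG + `|ln Z| + B.

(** Up to the first switch the weight is a tail, geometric up to the factor [expR B]; from there on
    [renewal_weight_log] applies. *)
Let stationary_weight_log m a z :
  `|ln (stationary_weight (z 0%N) a (mkseq (full_shift z) m))
    + \sum_(i < m) psi (iter i full_shift z) - a.+1%:R * ln q| <= CE.
Proof.
have B0 : 0 <= B := le_trans (normr_ge0 _) (tail_log false 0).
have F0 : 0 <= `|ln (tail false 0)| by exact: normr_ge0.
have F1 : 0 <= `|ln (tail true 0)| by exact: normr_ge0.
have Z0 : 0 <= `|ln Z| by exact: normr_ge0.
have lF s : `|ln (tail s 0)| <= CG.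
  by move: t0 B0 F0 F1; rewrite /CG; case: s; lra.
elim: m a z => [|m IH] a z.
  rewrite big_ord0 addr0 [mkseq _ 0]/= [stationary_weight _ _ _]/= ln_div ?posrE//.
  rewrite lnM ?posrE//; have := tail2_log (z 0%N) a; have := lF (z 0%N).
  have := ler_norm (ln Z); have := ler_norm (- ln Z); rewrite normrN.
  by rewrite /CE /CG !ler_norml; lra.
rewrite mkseq_shift sum_psiS [stationary_weight _ _ (_ :: _)]/=.
have z1 : full_shift z 0%N = z 1%N by [].
rewrite z1; have [zz|zz] := eqVneq (z 1%N) (z 0%N).
  have := IH a.+1 (full_shift z); rewrite z1 zz.
  rewrite /psi {2}/renewal_potential zz eqxx mulr0 subr0.
  by congr (`| _ | <= _); rewrite -[a.+2]addn1 natrD; ring.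
have := renewal_weight_log m 0 (full_shift z); rewrite z1.
rewrite lnM ?posrE ?divr_gt0//; last exact: renewal_weight_gt0.
rewrite ln_div ?posrE// lnM ?posrE//.
rewrite /psi {2}/renewal_potential eq_sym (negbTE zz).
have := tail_log (z 0%N) a; have := lF (z 0%N).
have : `|lk (z 1%N)| <= CG.
  rewrite /lk; case: (z 1%N); first exact: lF.
  by rewrite normr0; exact: le_trans (normr_ge0 _) (lF true).
have := ler_norm (ln Z); have := ler_norm (- ln Z); rewrite normrN.
by rewrite /CE /CG !ler_norml; lra.
Qed.

Lemma word_weight_gibbs : exists C : R, forall (x : borel_cantor) n,
  `|- ln (word_weight (mkseq x n))
    - \sum_(i < n) (- ln q - t * renewal_potential (iter i full_shift x))| <= C.
Proof.
exists (CE + 2 * `|ln q| + t) => x [|m].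
  rewrite big_ord0 [mkseq _ 0]/= ln1 oppr0 addr0 normr0.
  have CE0 : 0 <= CE := le_trans (normr_ge0 _) (stationary_weight_log 0 0 x).
  by rewrite addr_ge0// addr_ge0// mulr_ge0.
(* A word of [m.+1] symbols has [m] transitions; the last value of the potential is simply
   bounded. *)
rewrite mkseq_shift [word_weight _]/= big_ord_recr/=.
have := stationary_weight_log m 0 x.
rewrite /psi; set y := iter m full_shift x.
have := ler_wpM2l t0 (renewal_potential_geN1 y).
have := mulr_ge0_le0 t0 (renewal_potential_le0 y).
have := ler_norm (ln q); have := ler_norm (- ln q); rewrite normrN.
by rewrite !ler_norml; lra.
Qed.

End renewal_weights.
End potential.

(** * Tails of series *)

Section series_tails.
Variable R : realType.
Implicit Types (v w : nat -> R) (C rho : R).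

Definition tail_sum v a : R := limn (series (fun k => v (a + k)%N)).

(** Such a bound passes from a sequence to its tails, so it serves for tails of tails as well. *)
Definition geo_bounded C rho v := forall k, 0 <= v k <= C * rho ^+ k.

Section fixed_bound.
Variables (C rho : R).
Hypothesis rho0 : 0 <= rho.
Hypothesis rho1 : rho < 1.

Let geo_cvg a : series (fun k => C * rho ^+ (a + k)) @ \oo --> C * rho ^+ a / (1 - rho).
Proof.
rewrite (_ : (fun k => _) = geometric (C * rho ^+ a) rho).
  by apply: cvg_geometric_series; rewrite ger0_norm.
by apply/funext => k; rewrite /geometric /= exprD mulrA.
Qed.

Lemma tail_sum_is_cvg v a :
  geo_bounded C rho v -> cvgn (series (fun k => v (a + k)%N)).
Proof.
move=> vb; apply: (@series_le_cvg _ _ (fun k => C * rho ^+ (a + k))).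
- by move=> n; have /andP[] := vb (a + n)%N.
- by move=> n; have /andP[v0] := vb (a + n)%N; exact: le_trans.
- by move=> n; have /andP[] := vb (a + n)%N.
- by apply/cvg_ex; eexists; exact: geo_cvg.
Qed.

Lemma tail_sumS v a : geo_bounded C rho v ->
  tail_sum v a = v a + tail_sum v a.+1.
Proof.
move=> vb; apply/cvg_lim => //; rewrite -(cvg_shiftS (series _)).
rewrite (_ : (fun n => _) = fun n => v a + series (fun k => v (a.+1 + k)%N) n).
  by apply: cvgD; [exact: cvg_cst|exact: tail_sum_is_cvg].
apply/funext => n; rewrite !seriesEord /= big_ord_recl addn0; congr (_ + _).
by apply: eq_bigr => i _; rewrite /bump /= addSnnS.
Qed.

Lemma tail_sum_split n v a : geo_bounded C rho v ->
  tail_sum v a = \sum_(k < n) v (a + k)%N + tail_sum v (a + n).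
Proof.
move=> vb; elim: n => [|n IH]; first by rewrite big_ord0 add0r addn0.
by rewrite IH big_ord_recr/= -addrA addnS -tail_sumS.
Qed.

Lemma tail_sum_le v w a : geo_bounded C rho v -> geo_bounded C rho w ->
  (forall k, (a <= k)%N -> v k <= w k) -> tail_sum v a <= tail_sum w a.
Proof.
move=> vb wb vw; apply: lim_series_le; [exact: tail_sum_is_cvg..|].
by move=> n; apply: vw; rewrite leq_addr.
Qed.

Lemma tail_sum_geometric a :
  tail_sum (fun k => C * rho ^+ k) a = C * rho ^+ a / (1 - rho).
Proof. by apply/cvg_lim => //; exact: geo_cvg. Qed.

Lemma tail_sum_ge0 v a : geo_bounded C rho v -> 0 <= tail_sum v a.
Proof.
move=> vb; apply: limr_ge; first exact: tail_sum_is_cvg.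
near=> n; apply: sumr_ge0 => i _; by have /andP[] := vb (a + i)%N.
Unshelve. all: by end_near. Qed.

Lemma tail_sum_ub v a : geo_bounded C rho v ->
  tail_sum v a <= C * rho ^+ a / (1 - rho).
Proof.
move=> vb; rewrite -tail_sum_geometric; apply: tail_sum_le => //.
  move=> k; rewrite lexx andbT; have /andP[v0] := vb k; exact: le_trans.
by move=> k _; have /andP[] := vb k.
Qed.

Lemma geo_bounded_tail_sum v : geo_bounded C rho v ->
  geo_bounded (C / (1 - rho)) rho (tail_sum v).
Proof.
by move=> vb k; rewrite tail_sum_ge0// mulrAC; exact: tail_sum_ub.
Qed.

(** Finitely many terms converge, and the common geometric bound makes the rest uniformly small. *)
Lemma tannery_tail_sum (I : Type) (F : set_system I) {FF : Filter F}
    (v : I -> nat -> R) w a :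
  (\forall i \near F, geo_bounded C rho (v i)) -> geo_bounded C rho w ->
  (forall k, v i k @[i --> F] --> w k) ->
  tail_sum (v i) a @[i --> F] --> tail_sum w a.
Proof.
move=> vb wb vw; apply/cvgrPdist_lt => e e0.
have e20 : 0 < e / 2 by rewrite divr_gt0.
have [n ne] : exists n, C * rho ^+ (a + n) / (1 - rho) < e / 2.
  have : C * rho ^+ (a + n) / (1 - rho) @[n --> \oo]
      --> C * (rho ^+ a * 0) / (1 - rho).
    apply: cvgMl; apply: cvgMr.
    under eq_fun do rewrite exprD; apply: cvgMr.
    by apply: cvg_expr; rewrite ger0_norm.
  rewrite !mulr0 mul0r => /cvgrPdist_lt/(_ _ e20)[n _ /(_ n (leqnn n))].
  by rewrite sub0r normrN => /(le_lt_trans (ler_norm _)); exists n.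
have cvg_sum : \sum_(k < n) v i (a + k)%N @[i --> F] --> \sum_(k < n) w (a + k)%N.
  by apply: cvg_big => [|k _]; [exact: add_continuous|exact: vw].
move/cvgrPdist_lt : cvg_sum => /(_ _ e20) near_sum.
near=> i.
have vbi : geo_bounded C rho (v i) by near: i.
rewrite (tail_sum_split n _ vbi) (tail_sum_split n _ wb).
have := tail_sum_ge0 (a + n) vbi; have := tail_sum_ge0 (a + n) wb.
have := tail_sum_ub (a + n) vbi; have := tail_sum_ub (a + n) wb.
have : `|\sum_(k < n) w (a + k)%N - \sum_(k < n) v i (a + k)%N| < e / 2 by near: i.
by rewrite !ltr_norml; lra.
Unshelve. all: by end_near. Qed.

End fixed_bound.
End series_tails.

(** * The pressure equation *)

Section pressure.
Variables (R : realType) (c : bool -> nat -> R).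
Hypothesis c0 : forall s a, 0 <= c s a.
Hypothesis c1 : forall s a, c s a <= 1.
Implicit Types (t q : R) (s : bool).

Definition run_weight t q s a : R := q ^+ a.+1 * expR (- (t * c s a)).
Definition run_tail t q s a : R := tail_sum (run_weight t q s) a.
Definition run_tail2 t q s a : R := tail_sum (run_tail t q s) a.

(** Allowing [rho] above [q] gives one bound for all parameters close to a given one. *)
Lemma run_weight_bounded t q s rho : 0 <= t -> 0 <= q -> q <= rho -> rho < 1 ->
  geo_bounded 1 rho (run_weight t q s).
Proof.
move=> t0 q0 qr r1 k; rewrite mulr_ge0 ?exprn_ge0 ?expR_ge0//= mul1r.
have rho0 := le_trans q0 qr.
rewrite -[leRHS]mulr1 ler_pM ?exprn_ge0 ?expR_ge0//.
  apply: (@le_trans _ _ (q ^+ k)); last by rewrite lerXn2r ?nnegrE.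
  by rewrite exprS ler_piMl ?exprn_ge0// (le_trans qr)// ltW.
by rewrite expR_le1 oppr_le0 mulr_ge0.
Qed.

Section fixed_parameters.
Variables t q : R.
Hypothesis t0 : 0 <= t.
Hypothesis q0 : 0 < q.
Hypothesis q1 : q < 1.

Let bw s : geo_bounded 1 q (run_weight t q s).
Proof. exact (run_weight_bounded s t0 (ltW q0) (lexx q) q1). Qed.

Let bt s : geo_bounded (1 / (1 - q)) q (run_tail t q s).
Proof. exact (geo_bounded_tail_sum (ltW q0) q1 (bw s)). Qed.

Lemma run_tailS s a : run_tail t q s a = run_weight t q s a + run_tail t q s a.+1.
Proof. exact (tail_sumS (ltW q0) q1 a (bw s)). Qed.

Lemma run_tail2S s a : run_tail2 t q s a = run_tail t q s a + run_tail2 t q s a.+1.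
Proof. exact (tail_sumS (ltW q0) q1 a (bt s)). Qed.

Lemma run_weight_gt0 s a : 0 < run_weight t q s a.
Proof. by rewrite mulr_gt0 ?exprn_gt0 ?expR_gt0. Qed.

Lemma run_tail_ge0 s a : 0 <= run_tail t q s a.
Proof. exact (tail_sum_ge0 (ltW q0) q1 a (bw s)). Qed.

Lemma run_tail_gt0 s a : 0 < run_tail t q s a.
Proof. by rewrite run_tailS ltr_pwDl ?run_weight_gt0 ?run_tail_ge0. Qed.

Lemma run_tail2_ge0 s a : 0 <= run_tail2 t q s a.
Proof. exact (tail_sum_ge0 (ltW q0) q1 a (bt s)). Qed.

Lemma run_tail_le_tail2 s a : run_tail t q s a <= run_tail2 t q s a.
Proof. by rewrite run_tail2S lerDl run_tail2_ge0. Qed.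

Lemma run_tail2_gt0 s a : 0 < run_tail2 t q s a.
Proof. exact: lt_le_trans (run_tail_gt0 s a) (run_tail_le_tail2 s a). Qed.

Lemma run_weight_le s a : run_weight t q s a <= q * q ^+ a.
Proof.
rewrite /run_weight -exprS -[leRHS]mulr1 ler_wpM2l ?exprn_ge0 ?(ltW q0)//.
by rewrite expR_le1 oppr_le0 mulr_ge0.
Qed.

Lemma run_tail_le s a : run_tail t q s a <= q ^+ a.+1 / (1 - q).
Proof.
rewrite exprS /run_tail; apply: (tail_sum_ub (C := q) (ltW q0) q1 a) => k.
by rewrite run_weight_le ltW ?run_weight_gt0.
Qed.

Lemma run_tail2_le s a : run_tail2 t q s a <= q ^+ a.+1 / (1 - q) / (1 - q).
Proof.
rewrite exprS [q * _ / _]mulrAC /run_tail2.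
apply: (tail_sum_ub (C := q / (1 - q)) (ltW q0) q1 a) => k.
by rewrite run_tail_ge0 mulrAC -exprS run_tail_le.
Qed.

Lemma run_tail_ge s a u : (forall k, (a <= k)%N -> t * c s k <= u) ->
  expR (- u) * (q ^+ a.+1 / (1 - q)) <= run_tail t q s a.
Proof.
move=> cu; have e1 : expR (- u) <= 1.
  rewrite expR_le1 oppr_le0; apply: le_trans (cu a (leqnn a)).
  exact: mulr_ge0.
rewrite mulrA exprS [expR _ * _]mulrA -tail_sum_geometric//; last exact: ltW.
apply: (@tail_sum_le _ 1 q (ltW q0) q1) => // k.
  rewrite !mulr_ge0 ?expR_ge0 ?exprn_ge0 ?(ltW q0)//= ler_wpM2r ?exprn_ge0 ?(ltW q0)//.
  by rewrite mulr_ile1 ?expR_ge0 ?(ltW q0)// ltW.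
move=> ak; rewrite /run_weight -mulrA -exprS mulrC ler_wpM2l ?exprn_ge0 ?(ltW q0)//.
by rewrite ler_expR lerN2 cu.
Qed.

Let B : R := t + (- ln (1 - q) - ln (1 - q)).

(** From below by the first term of the tail, from above by geometric series in which all runs are
    free. *)
Lemma run_tail_log s a : `|ln (run_tail t q s a) - a.+1%:R * ln q| <= B /\
  `|ln (run_tail2 t q s a) - a.+1%:R * ln q| <= B.
Proof.
have q1' : 0 < 1 - q by rewrite subr_gt0.
have l0 : ln (1 - q) <= 0 by rewrite ln_le0// gerBl ltW.
have low : a.+1%:R * ln q - t <= ln (run_tail t q s a).
  have := @run_tailS s a; have := run_tail_ge0 s a.+1 => tl0 tE.
  apply: (@le_trans _ _ (ln (run_weight t q s a))); last first.
    by rewrite ler_ln ?posrE ?run_weight_gt0 ?run_tail_gt0// tE lerDl.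
  rewrite /run_weight lnM ?posrE ?exprn_gt0 ?expR_gt0// lnXn// expRK mulr_natl.
  by rewrite lerD2l lerN2 ler_piMr.
have low2 : ln (run_tail t q s a) <= ln (run_tail2 t q s a).
  by rewrite ler_ln ?posrE ?run_tail_gt0 ?run_tail2_gt0// run_tail_le_tail2.
have up : ln (run_tail2 t q s a) <= a.+1%:R * ln q - ln (1 - q) - ln (1 - q).
  have -> : a.+1%:R * ln q - ln (1 - q) - ln (1 - q) = ln (q ^+ a.+1 / (1 - q) / (1 - q)).
    by rewrite !ln_div ?posrE ?divr_gt0 ?exprn_gt0// lnXn// mulr_natl.
  by rewrite ler_ln ?posrE ?run_tail2_gt0 ?divr_gt0 ?exprn_gt0// run_tail2_le.
by split; move: t0; rewrite /B ler_norml; lra.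
Qed.

End fixed_parameters.

Definition pressure_fun t q := run_tail t q false 0 * run_tail t q true 0.

Lemma run_tail_mono_q t q q' s : 0 <= t -> 0 < q -> q < q' -> q' < 1 ->
  run_tail t q s 0 < run_tail t q' s 0.
Proof.
move=> t0 q0 qq' q'1; have q1 := lt_trans qq' q'1; have q'0 := lt_trans q0 qq'.
rewrite [X in X < _]run_tailS// [X in _ < X]run_tailS//; apply: ltr_leD.
  by rewrite /run_weight !expr1 ltr_pM2r ?expR_gt0.
apply: (@tail_sum_le _ 1 q' (ltW q'0) q'1).
- exact (run_weight_bounded s t0 (ltW q0) (ltW qq') q'1).
- exact (run_weight_bounded s t0 (ltW q'0) (lexx _) q'1).
- move=> k _; rewrite /run_weight ler_pM2r ?expR_gt0// lerXn2r ?nnegrE ?ltW//.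
Qed.

Lemma pressure_fun_mono t q q' : 0 <= t -> 0 < q -> q < q' -> q' < 1 ->
  pressure_fun t q < pressure_fun t q'.
Proof.
move=> t0 q0 qq' q'1; have q1 := lt_trans qq' q'1.
by rewrite ltr_pM ?run_tail_ge0 ?run_tail_mono_q.
Qed.

Section continuity.
Variables (I : Type) (F : set_system I) (FF : ProperFilter F).
Variables (t_ q_ : I -> R) (t q : R).
Hypothesis t_ge0 : \forall i \near F, 0 <= t_ i.
Hypothesis t0 : 0 <= t.
Hypothesis q0 : 0 < q.
Hypothesis q1 : q < 1.
Hypothesis cvg_t : t_ i @[i --> F] --> t.
Hypothesis cvg_q : q_ i @[i --> F] --> q.

Let rho := (1 + q) / 2.
Let rho0 : 0 <= rho. Proof. by move: q0; rewrite /rho; lra. Qed.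
Let rho1 : rho < 1. Proof. by move: q1; rewrite /rho; lra. Qed.
Let q_rho : q < rho. Proof. by move: q1; rewrite /rho; lra. Qed.

Let bounded_near s : \forall i \near F, geo_bounded 1 rho (run_weight (t_ i) (q_ i) s).
Proof.
near=> i; apply: run_weight_bounded => //.
- by near: i.
- by apply: ltW; near: i; exact: (cvgr_gt q).
- by apply: ltW; near: i; exact: (cvgr_lt q).
Unshelve. all: by end_near. Qed.

Let bw s : geo_bounded 1 rho (run_weight t q s).
Proof. exact (run_weight_bounded s t0 (ltW q0) (ltW q_rho) rho1). Qed.

Lemma cvg_run_weight s a :
  run_weight (t_ i) (q_ i) s a @[i --> F] --> run_weight t q s a.
Proof.
apply: cvgM.
  apply: (@continuous_cvg _ _ _ F _ q_ (fun z : R => z ^+ a.+1) q) => //.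
  exact: exprn_continuous.
apply: (@continuous_cvg _ _ _ F _ (fun i => - (t_ i * c s a)) expR (- (t * c s a))).
  exact: continuous_expR.
by apply: cvgN; apply: cvgM => //; exact: cvg_cst.
Qed.

Lemma cvg_run_tail s a :
  run_tail (t_ i) (q_ i) s a @[i --> F] --> run_tail t q s a.
Proof.
rewrite /run_tail.
apply: (@tannery_tail_sum R 1 rho rho0 rho1 I F _ (fun i => run_weight (t_ i) (q_ i) s)) => //.
move=> k; exact: cvg_run_weight.
Qed.

Lemma cvg_run_tail2 s a :
  run_tail2 (t_ i) (q_ i) s a @[i --> F] --> run_tail2 t q s a.
Proof.
rewrite /run_tail2; apply: (@tannery_tail_sum R (1 / (1 - rho)) rho rho0 rho1 I F _
  (fun i => run_tail (t_ i) (q_ i) s)) => [||k].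
- have bn := bounded_near s; near=> i.
  suff bi : geo_bounded 1 rho (run_weight (t_ i) (q_ i) s).
    exact (geo_bounded_tail_sum rho0 rho1 bi).
  by near: i.
- exact (geo_bounded_tail_sum rho0 rho1 (bw s)).
- exact: cvg_run_tail.
Unshelve. all: by end_near. Qed.

Lemma cvg_pressure_fun :
  pressure_fun (t_ i) (q_ i) @[i --> F] --> pressure_fun t q.
Proof. by apply: cvgM; exact: cvg_run_tail. Qed.

End continuity.

Lemma pressure_root_exists t : 0 <= t ->
  exists q, [/\ 2^-1 <= q, q < 1 & pressure_fun t q = 1].
Proof.
(* [b] solves [e * b / (1 - b) = 1]: even with all costs equal to 1 both tails would reach 1 there.
   At 1/2, free runs would have total weight exactly 1, so both tails are at most 1. *)
move=> t0; pose e := expR (- t); pose b := (1 + e)^-1.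
have e0 : 0 < e := expR_gt0 _.
have e1 : e <= 1 by rewrite expR_le1 oppr_le0.
have b0 : 0 < b by rewrite invr_gt0; lra.
have b1 : b < 1 by rewrite invf_lt1; lra.
have hb : 2^-1 <= b by rewrite lef_pV2 ?posrE; lra.
have at_half : pressure_fun t 2^-1 <= 1.
  have F1 s : run_tail t 2^-1 s 0 <= 1.
    have h1 : 2^-1 < 1 :> R by rewrite invf_lt1 ?ltr1n.
    apply: le_trans (run_tail_le _ _ _ _ _) _ => //.
    rewrite expr1 [X in _ / X](_ : _ = 2^-1); last by field.
    by rewrite divff.
  by rewrite mulr_ile1 ?run_tail_ge0// invf_lt1 ?ltr1n.
have at_b : 1 <= pressure_fun t b.
  have F1 s : 1 <= run_tail t b s 0.
    apply: le_trans (run_tail_ge (u := t) _ _ _ _) => //; last first.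
      by move=> k _; rewrite ler_piMr.
    have e1N : 1 + e != 0 by rewrite gt_eqF// addr_gt0.
    have bE : 1 - b = e * b by rewrite /b; field.
    rewrite -/e expr1 bE; have eN := lt0r_neq0 e0; have bN := lt0r_neq0 b0.
    by rewrite le_eqVlt; apply/orP; left; apply/eqP; field; rewrite eN bN.
  by rewrite -[1]mulr1 ler_pM.
have cont : {within `[2^-1, b], continuous (pressure_fun t)}.
  apply: continuous_in_subspaceT => q; rewrite inE/= in_itv/= => /andP[hq qb].
  have qpos : 0 < q by apply: lt_le_trans hq; rewrite invr_gt0.
  have qlt : q < 1 := le_lt_trans qb b1.
  apply: (@cvg_pressure_fun _ (nbhs q) _ (fun=> t) id) => //; last exact: cvg_cst.
  exact: nearW.
have [|q] := IVT hb cont (v := 1).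
  by rewrite ge_min le_max at_half at_b orbT.
by rewrite in_itv/= => /andP[hq qb] Pq; exists q; split=> //; exact: le_lt_trans qb b1.
Qed.

End pressure.

(** * The pressure root and the symbol frequencies as functions of the inverse temperature *)

Section root.
Variables (R : realType) (c : bool -> nat -> R).
Hypothesis c0 : forall s a, 0 <= c s a.
Hypothesis c1 : forall s a, c s a <= 1.
Implicit Types (t q : R) (s : bool).

(** For [0 <= t] the root is unique by [pressure_fun_mono]. *)
Definition pressure_root t : R :=
  get [set q : R | [/\ 2^-1 <= q, q < 1 & pressure_fun c t q = 1]].

Lemma pressure_rootP t : 0 <= t -> [/\ 2^-1 <= pressure_root t,
  pressure_root t < 1 & pressure_fun c t (pressure_root t) = 1].
Proof.
move=> t0; pose S := [set q : R | [/\ 2^-1 <= q, q < 1 & pressure_fun c t q = 1]].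
exact: (@getPex _ S (pressure_root_exists c0 c1 t0)).
Qed.

Lemma pressure_root_gt0 t : 0 <= t -> 0 < pressure_root t.
Proof. by move=> /pressure_rootP[+ _ _]; apply: lt_le_trans; rewrite invr_gt0. Qed.

Lemma pressure_root_lt1 t : 0 <= t -> pressure_root t < 1.
Proof. by case/pressure_rootP. Qed.

(** At [t] the pressure function is below 1 at [a] and above 1 at [b]. By continuity this persists
    for [u] near [t], and monotonicity then traps the root between [a] and [b]. *)
Lemma pressure_root_cvg t : 0 < t -> pressure_root u @[u --> t] --> pressure_root t.
Proof.
move=> t0; have [h q1 Pq] := pressure_rootP (ltW t0).
have q0 := pressure_root_gt0 (ltW t0); set q := pressure_root t in h q1 Pq q0 *.
have near0 : \forall u \near t, 0 <= u.
  by near=> u; apply: ltW; near: u; exact: lt_nbhsr.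
have cvg_at p : 0 < p -> p < 1 -> pressure_fun c u p @[u --> t] --> pressure_fun c t p.
  move=> p0 p1; apply: (@cvg_pressure_fun _ _ c0 _ (nbhs t) _ id (fun=> p)) => //.
  - exact: ltW.
  - exact: cvg_cst.
apply/cvgrPdist_lt => e e0.
pose a := Num.max (q / 2) (q - e / 2); pose b := Num.min ((1 + q) / 2) (q + e / 2).
have a0 : 0 < a by rewrite lt_max divr_gt0.
have aq : a < q by rewrite gt_max; apply/andP; split; lra.
have b1 : b < 1 by rewrite gt_min; apply/orP; left; lra.
have qb : q < b by rewrite lt_min; apply/andP; split; lra.
have ae : q - e < a by rewrite lt_max; apply/orP; right; lra.
have be : b < q + e by rewrite gt_min; apply/orP; right; lra.
have b0 := lt_trans q0 qb; have a1 := lt_trans aq q1.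
have Pa : pressure_fun c t a < 1 by rewrite -Pq; apply: pressure_fun_mono => //; exact: ltW.
have Pb : 1 < pressure_fun c t b by rewrite -Pq; apply: pressure_fun_mono => //; exact: ltW.
have near_a : \forall u \near t, pressure_fun c u a < 1 by exact: (cvgr_lt _ (cvg_at _ a0 a1)).
have near_b : \forall u \near t, 1 < pressure_fun c u b by exact: (cvgr_gt _ (cvg_at _ b0 b1)).
near=> u.
have u0 : 0 <= u by near: u.
have [_ r1 Pr] := pressure_rootP u0; have r0 := pressure_root_gt0 u0.
set r := pressure_root u in r1 Pr r0 *.
have ar : a < r.
  rewrite ltNge le_eqVlt; apply/negP => /predU1P[ra|ra].
    have : pressure_fun c u a < 1 by near: u.
    by rewrite -ra Pr ltxx.
  have := pressure_fun_mono c0 u0 r0 ra a1; rewrite Pr => h1.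
  have : pressure_fun c u a < 1 by near: u.
  by rewrite ltNge (ltW h1).
have rb : r < b.
  rewrite ltNge le_eqVlt; apply/negP => /predU1P[ra|ra].
    have : 1 < pressure_fun c u b by near: u.
    by rewrite ra Pr ltxx.
  have := pressure_fun_mono c0 u0 b0 ra r1; rewrite Pr => h1.
  have : 1 < pressure_fun c u b by near: u.
  by rewrite ltNge (ltW h1).
by rewrite ltr_norml; move: ar rb ae be; clear; lra.
Unshelve. all: by end_near. Qed.

Definition mean_run t s : R :=
  run_tail2 c t (pressure_root t) s 0 / run_tail c t (pressure_root t) s 0.

Definition mean_cycle t : R := mean_run t false + mean_run t true.

Definition symbol_freq t s : R := mean_run t s / mean_cycle t.

Lemma mean_run_gt0 t s : 0 <= t -> 0 < mean_run t s.
Proof.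
move=> t0; have q0 := pressure_root_gt0 t0; have q1 := pressure_root_lt1 t0.
by rewrite divr_gt0 ?run_tail2_gt0 ?run_tail_gt0.
Qed.

Lemma mean_cycle_gt0 t : 0 <= t -> 0 < mean_cycle t.
Proof. by move=> t0; rewrite addr_gt0 ?mean_run_gt0. Qed.

Lemma mean_run_cvg t s : 0 < t -> mean_run u s @[u --> t] --> mean_run t s.
Proof.
move=> t0; have q0 := pressure_root_gt0 (ltW t0); have q1 := pressure_root_lt1 (ltW t0).
have near0 : \forall u \near t, 0 <= u.
  by near=> u; apply: ltW; near: u; exact: lt_nbhsr.
have rc := pressure_root_cvg t0.
apply: cvgM.
  by apply: (@cvg_run_tail2 _ _ c0 _ (nbhs t) _ id pressure_root) => //; exact: ltW.
apply: cvgV; first by rewrite gt_eqF// run_tail_gt0// ltW.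
by apply: (@cvg_run_tail _ _ c0 _ (nbhs t) _ id pressure_root) => //; exact: ltW.
Unshelve. all: by end_near. Qed.

Lemma symbol_freq_cvg t s : 0 < t -> symbol_freq u s @[u --> t] --> symbol_freq t s.
Proof.
move=> t0; apply: cvgM; first exact: mean_run_cvg.
apply: cvgV; first by rewrite gt_eqF// mean_cycle_gt0// ltW.
by apply: cvgD; exact: mean_run_cvg.
Qed.

Lemma symbol_freqD t : 0 <= t -> symbol_freq t false + symbol_freq t true = 1.
Proof. by move=> t0; rewrite -mulrDl divff// gt_eqF// mean_cycle_gt0. Qed.

(** A median bound: the tails decrease, so the first [n] of them are all at least half of the total
    weight, and the mean is their sum over that weight. *)
Lemma mean_run_ge t s n : 0 <= t ->
  \sum_(k < n) run_weight c t (pressure_root t) s k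
    <= run_tail c t (pressure_root t) s 0 / 2 ->
  n%:R / 2 <= mean_run t s.
Proof.
move=> t0; have q0 := pressure_root_gt0 t0; have q1 := pressure_root_lt1 t0.
rewrite /mean_run; set q := pressure_root t in q0 q1 *.
have split_tail m : run_tail c t q s 0 =
    \sum_(k < m) run_weight c t q s k + run_tail c t q s m.
  elim: m => [|m IH]; first by rewrite big_ord0 add0r.
  by rewrite big_ord_recr/= -addrA -run_tailS.
have split_tail2 m : \sum_(k < m) run_tail c t q s k <= run_tail2 c t q s 0.
  suff -> : run_tail2 c t q s 0 = \sum_(k < m) run_tail c t q s k + run_tail2 c t q s m.
    by rewrite lerDl run_tail2_ge0.
  elim: m => [|m IH]; first by rewrite big_ord0 add0r.
  by rewrite big_ord_recr/= -addrA -run_tail2S.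
move=> small; have half : run_tail c t q s 0 / 2 <= run_tail c t q s n.
  by have := split_tail n; lra.
rewrite ler_pdivlMr ?run_tail_gt0//; apply: le_trans (split_tail2 n).
apply: (@le_trans _ _ (\sum_(k < n) run_tail c t q s n)).
  by rewrite sumr_const card_ord -[leRHS]mulr_natl -mulrA [2^-1 * _]mulrC ler_wpM2l.
apply: ler_sum => k _; have := split_tail n; rewrite (split_tail k) => eq_split.
have : \sum_(i < k) run_weight c t q s i <= \sum_(i < n) run_weight c t q s i.
  rewrite -(big_mkord xpredT (run_weight c t q s)) -[leRHS](big_mkord xpredT (run_weight c t q s)).
  rewrite [leRHS](@big_cat_nat _ _ _ k)//=; last exact: ltnW.
  by rewrite lerDl sumr_ge0// => i _; rewrite ltW// run_weight_gt0.
by lra.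
Qed.

(** As the product of the total weights is 1, some symbol has total weight at least 1, while its [n]
    shortest runs become negligible for large [t]; then [mean_run_ge] applies. *)
Lemma mean_cycle_large (K : R) : (forall s a, 0 < c s a) ->
  exists T, forall t, T <= t -> 0 <= t -> K <= mean_cycle t.
Proof.
move=> cpos; pose n := (Num.truncn (2 * `|K|)).+1.
have Kn : K <= n%:R / 2.
  rewrite ler_pdivlMr// mulrC; apply: le_trans (ltW (truncnS_gt _)).
  by rewrite ler_wpM2l// ler_norm.
have [d d0 d_le] : exists2 d, 0 < d & forall s k, (k < n)%N -> d <= c s k.
  elim: (n) => [|m [d d0 d_le]]; first by exists 1.
  exists (Num.min d (Num.min (c false m) (c true m))).
    by rewrite !lt_min d0 !cpos.
  move=> s k; rewrite ltnS leq_eqVlt => /predU1P[->|km]; last first.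
    by rewrite ge_min d_le.
  by case: s; rewrite !ge_min lexx ?orbT.
(* Beyond this point [n%:R * expR (- (t * d)) <= n%:R / (t * d) <= 2^-1]. *)
exists (2 * n%:R / d) => t tT t0.
have small : n%:R * expR (- (t * d)) <= 2^-1.
  have td : 2 * n%:R <= t * d by rewrite -ler_pdivrMr.
  have ge_td : t * d <= expR (t * d) by have := @expR_ge1Dx R (t * d); lra.
  rewrite expRN ler_pdivrMr ?expR_gt0//; lra.
have q0 := pressure_root_gt0 t0; have [_ q1 Pq] := pressure_rootP t0.
have [s s1] : exists s, 1 <= run_tail c t (pressure_root t) s 0.
  have [F1|F1] := leP 1 (run_tail c t (pressure_root t) false 0); first by exists false.
  exists true; rewrite -Pq /pressure_fun ler_piMl ?run_tail_ge0//; exact: ltW.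
apply: (@le_trans _ _ (mean_run t s)); last first.
  have mf := mean_run_gt0 false t0; have mt := mean_run_gt0 true t0.
  by rewrite /mean_cycle; move: mf mt; clear; case: (s); lra.
apply: le_trans Kn _; apply: mean_run_ge => //.
apply: (@le_trans _ _ (\sum_(k < n) expR (- (t * d)))); last first.
  by rewrite sumr_const card_ord -mulr_natl; lra.
apply: ler_sum => k _; apply: le_trans (_ : 1 * expR (- (t * c s k)) <= _).
  by rewrite /run_weight ler_wpM2r ?expR_ge0// exprn_ile1 ?ltW.
by rewrite mul1r ler_expR lerN2 ler_wpM2l ?d_le.
Qed.

(* At temperature 1/t, runs of [s] shorter than [N] are too expensive, while those
   of the other symbol are already free from length [M] on, with [M] much less
   than [N]. *)
Section dominance.
Variables (t : R) (s : bool) (N M : nat).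
Hypothesis t0 : 0 <= t.
Hypothesis long_forbidden : forall a, (a < N)%N -> N%:R <= t * c s a.
Hypothesis long_free : forall a, (N <= a)%N -> t * c s a <= 1.
Hypothesis short_free : forall a, (M <= a)%N -> t * c (~~ s) a <= 1.
Hypothesis M_ge : (16 <= M)%N.
Hypothesis MN : (M ^ 4 <= N)%N.

Let q := pressure_root t.
Let D := 1 - q.
Let F s := run_tail c t q s 0.
Let e := expR 1 : R.

Let q0 : 0 < q. Proof. exact: pressure_root_gt0. Qed.
Let q1 : q < 1. Proof. exact: pressure_root_lt1. Qed.
Let qh : 2^-1 <= q. Proof. by have [] := pressure_rootP t0. Qed.
Let D0 : 0 < D. Proof. by rewrite subr_gt0. Qed.
Let M16 : 16 <= M%:R :> R. Proof. by rewrite ler_nat. Qed.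
Let N4 : M%:R ^+ 4 <= N%:R :> R. Proof. by rewrite -natrX ler_nat. Qed.
Let N16 : 16 <= N%:R :> R.
Proof.
apply: le_trans N4; apply: le_trans M16 _.
by rewrite -[leLHS]expr1 ler_weXn2l//; move: M16; lra.
Qed.

Let FF1 : F s * F (~~ s) = 1.
Proof. by have [_ _] := pressure_rootP t0; rewrite /pressure_fun /F; case: (s) => //; rewrite mulrC. Qed.

Let F_ge0 u : 0 <= F u. Proof. exact: run_tail_ge0. Qed.

Let head_le : \sum_(k < N) run_weight c t q s k <= expR (- N%:R) / D.
Proof.
have geo : \sum_(k < N) q ^+ k <= D^-1.
  rewrite -[leRHS]mul1r ler_pdivlMr//.
  have := subrX1 q N; rewrite /D => eq_sub.
  have : 0 <= q ^+ N by rewrite exprn_ge0// ltW.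
  by rewrite mulrC; lra.
apply: (@le_trans _ _ (\sum_(k < N) expR (- N%:R) * q ^+ k)).
  apply: ler_sum => k _; rewrite /run_weight mulrC ler_pM ?expR_ge0 ?exprn_ge0 ?(ltW q0)//.
    by rewrite ler_expR lerN2 long_forbidden.
  by rewrite exprS ler_piMl ?exprn_ge0 ?ltW.
by rewrite -mulr_sumr ler_wpM2l ?expR_ge0.
Qed.

Let tail_split : F s = \sum_(k < N) run_weight c t q s k + run_tail c t q s N.
Proof.
rewrite /F; elim: (N) => [|m IH]; first by rewrite big_ord0 add0r.
by rewrite big_ord_recr/= -addrA -run_tailS.
Qed.

Let pow_le_exp : q ^+ N <= expR (- (N%:R * D)).
Proof.
rewrite -mulrN expRM_natl lerXn2r ?nnegrE ?expR_ge0 ?(ltW q0)//.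
by have := @expR_ge1Dx R (- D); rewrite /D; lra.
Qed.

(** The upper bounds on both tails and the pressure equation give
    [D ^+ 2 <= 2 * expR (- (N%:R * D))], and an exponential exceeds its exponent. *)
Let D_small : N%:R * D ^+ 3 <= 2.
Proof.
have Fs : F s <= (expR (- N%:R) + q ^+ N) / D.
  rewrite tail_split mulrDl lerD//; apply: le_trans (run_tail_le _ _ _ _ _ _) _ => //.
  by rewrite ler_pM2r ?invr_gt0// exprS ler_piMl ?exprn_ge0 ?ltW.
have Fns : F (~~ s) <= D^-1.
  apply: le_trans (run_tail_le _ _ _ _ _ _) _ => //.
  by rewrite expr1 ler_pdivrMr// mulVf ?gt_eqF// ltW.
have prod_le : 1 <= (expR (- N%:R) + q ^+ N) / D * D^-1.
  by rewrite -[leLHS]FF1 ler_pM ?F_ge0.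
have D2 : D ^+ 2 <= expR (- N%:R) + q ^+ N.
  by move: prod_le; rewrite -mulrA -invfM -expr2 ler_pdivlMr ?exprn_gt0// mul1r.
have ND0 : 0 <= N%:R * D by rewrite mulr_ge0// ltW.
have D1 : D <= 1 by rewrite gerBl ltW.
have D2' : D ^+ 2 <= 2 * expR (- (N%:R * D)).
  apply: le_trans D2 _; rewrite mulr_natl mulr2n lerD// ler_expR lerN2.
  by rewrite ler_piMr.
have : D ^+ 2 * (N%:R * D) <= 2.
  apply: (@le_trans _ _ (2 * expR (- (N%:R * D)) * expR (N%:R * D))).
    apply: ler_pM => //; first by rewrite exprn_ge0// ltW.
    by have := @expR_ge1Dx R (N%:R * D); lra.
  by rewrite -mulrA -expRD addNr expR0 mulr1.
by congr (_ <= _); ring.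
Qed.

(** The gap enters here: [M * (M * D) ^ 3 <= N * D ^ 3 <= 2], and [M >= 16] brings the cube down to
    1/8. *)
Let MD_small : M%:R * D <= 2^-1.
Proof.
have M0 : 0 < M%:R :> R by move: M16; lra.
have : (M%:R * D) ^+ 3 <= 8^-1.
  have : M%:R * (M%:R * D) ^+ 3 <= 2.
    apply: le_trans D_small.
    rewrite (_ : _ * _ = M%:R ^+ 4 * D ^+ 3); last by ring.
    by rewrite ler_wpM2r ?exprn_ge0 ?(ltW D0).
  rewrite -ler_pdivlMl// => /le_trans; apply.
  by rewrite ler_pdivrMl//; move: M16; lra.
apply: contraTT; rewrite -!ltNge => MD.
rewrite (_ : 8^-1 = 2^-1 ^+ 3); last by field.
by rewrite ltrXn2r ?nnegrE//; rewrite ltW// (lt_trans _ MD).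
Qed.

Let D_le : D <= 32^-1.
Proof.
have : 16 * D <= 2^-1 by apply: le_trans MD_small; rewrite ler_pM2r.
by lra.
Qed.

Let bernoulli m : 1 - m%:R * D <= q ^+ m.
Proof.
elim: m => [|m IH]; first by rewrite mul0r subr0 expr0.
rewrite exprS; apply: (@le_trans _ _ (q * (1 - m%:R * D))); last by rewrite ler_pM2l.
have : 0 <= m%:R * (D * D) by rewrite mulr_ge0// mulr_ge0// ltW.
by rewrite (_ : q = 1 - D) ?/D; [rewrite -natr1; lra|ring].
Qed.

Let eN1 : expR (-1) = e^-1 :> R. Proof. by rewrite expRN. Qed.
Let e_gt0 : 0 < e. Proof. exact: expR_gt0. Qed.

(** Since [M * D <= 1/2], Bernoulli keeps [q ^ M] above 1/2: discarding the runs before [M] costs a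
    constant factor only. *)
Let short_tail_ge : (4 * e * D)^-1 <= F (~~ s).
Proof.
apply: (@le_trans _ _ (run_tail c t q (~~ s) M)); last first.
  rewrite /F; elim: (M) => // m; apply: le_trans.
  by rewrite [leRHS]run_tailS// lerDr ltW// run_weight_gt0.
apply: le_trans (run_tail_ge c0 t0 q0 q1 short_free).
rewrite eN1 -/D invfM [_ * e]mulrC invfM -mulrA ler_pM2l ?invr_gt0//.
rewrite ler_pM2r ?invr_gt0// exprS.
have : 2^-1 <= q ^+ M by apply: le_trans (bernoulli M); move: MD_small; lra.
move=> qM; rewrite (_ : 4^-1 = 2^-1 * 2^-1 :> R); last by field.
by rewrite ler_pM.
Qed.

Let long_tail_ge : q ^+ N / (2 * e * D) <= run_tail c t q s N.
Proof.
apply: le_trans (run_tail_ge c0 t0 q0 q1 long_free).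
rewrite eN1 -/D invfM invfM [2^-1 * _]mulrC !mulrA [q ^+ N * _]mulrC -!mulrA.
rewrite ler_pM2l ?invr_gt0// !mulrA ler_pM2r ?invr_gt0// exprS mulrC.
by rewrite ler_pM2r ?exprn_gt0.
Qed.

(** From [1 / (1 - D) <= 1 + 2 * D], as [D] is small. *)
Let exp_le_pow : expR (- (2 * (N%:R * D))) <= q ^+ N.
Proof.
rewrite (_ : - (2 * (N%:R * D)) = N%:R * - (2 * D)); last by ring.
rewrite expRM_natl lerXn2r ?nnegrE ?expR_ge0 ?(ltW q0)// expRN.
rewrite -[leRHS]invrK lef_pV2 ?posrE ?expR_gt0 ?invr_gt0//.
apply: le_trans (expR_ge1Dx _).
rewrite -[leLHS]mul1r ler_pdivrMr// (_ : q = 1 - D); last by rewrite /D; ring.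
have : 0 <= D * (1 - 2 * D) by rewrite mulr_ge0 ?(ltW D0)//; move: D_le; lra.
by lra.
Qed.

(** The threshold of [s] in units of [1 / D], the length scale of the runs of the other symbol. *)
Let y := N%:R * D.

(** This forces [y] to infinity with [N]. The lower bounds on the two tails have product at most 1,
    so [q ^ N <= 8 * e ^ 2 * D ^ 2]; multiplied by [N ^ 2], with [exp_le_pow], this relates [N] to
    [y] alone. The 3 is a rounded square root of 8. *)
Lemma dominance_threshold : N%:R <= 3 * expR (2 * y + 1).
Proof.
have y0 : 0 <= y by rewrite mulr_ge0// ltW.
have qN : q ^+ N <= 8 * e ^+ 2 * D ^+ 2.
  have : q ^+ N / (2 * e * D) * (4 * e * D)^-1 <= 1.
    rewrite -[leRHS]FF1 ler_pM ?invr_ge0 ?divr_ge0 ?mulr_ge0 ?exprn_ge0 ?(ltW D0) ?(ltW e_gt0) ?(ltW q0)//.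
    apply: le_trans long_tail_ge _; rewrite tail_split lerDr sumr_ge0// => k _.
    by rewrite ltW// run_weight_gt0.
  rewrite -mulrA -invfM ler_pdivrMr ?mulr_gt0// mul1r => /le_trans; apply.
  by rewrite le_eqVlt; apply/orP; left; apply/eqP; ring.
have : N%:R ^+ 2 * expR (- (2 * y)) <= 8 * e ^+ 2 * y ^+ 2.
  apply: (@le_trans _ _ (N%:R ^+ 2 * (8 * e ^+ 2 * D ^+ 2))).
    by rewrite ler_wpM2l ?exprn_ge0// (le_trans exp_le_pow qN).
  by rewrite le_eqVlt; apply/orP; left; apply/eqP; rewrite /y; ring.
rewrite expRN ler_pdivrMr ?expR_gt0// => N2.
have y2 : y ^+ 2 <= expR (2 * y).
  rewrite expRM_natl lerXn2r ?nnegrE ?expR_ge0//.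
  by have := @expR_ge1Dx R y; lra.
rewrite -(@ler_pXn2r _ 2) ?nnegrE ?mulr_ge0 ?expR_ge0//.
apply: le_trans N2 _; rewrite [leRHS]exprMn.
have -> : expR (2 * y + 1) ^+ 2 = expR (2 * y) * expR (2 * y) * e ^+ 2.
  by rewrite expRD /e; ring.
set E := expR (2 * y) in y2 *; have E0 : 0 < E := expR_gt0 _.
have : 8 * e ^+ 2 * E * y ^+ 2 <= 8 * e ^+ 2 * E * E.
  by rewrite ler_wpM2l// !mulr_ge0 ?exprn_ge0 ?ltW.
have : 0 <= e ^+ 2 * E * E by rewrite !mulr_ge0 ?exprn_ge0 ?ltW.
by lra.
Qed.

(** The forbidden runs of [s] are negligible against its tail from [N] on, so its mean run is at
    least [N / 2]; that of the other symbol is at most [4 * e / D]. *)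
Lemma dominance_freq : 0 < y /\ symbol_freq t (~~ s) <= 8 * e / y.
Proof.
have N0 : 0 < N%:R :> R by move: N16; lra.
have y0 : 0 < y by rewrite mulr_gt0.
split=> //.
have long_mean : N%:R / 2 <= mean_run t s.
  apply: mean_run_ge => //; apply: le_trans head_le _.
  apply: (@le_trans _ _ (q ^+ N / (2 * e * D) / 2)); last first.
    rewrite ler_pM2r ?invr_gt0//; apply: le_trans long_tail_ge _.
    rewrite -/q -/(F s) tail_split lerDr sumr_ge0// => k _.
    by rewrite ltW// run_weight_gt0.
  rewrite invfM [X in _ <= X / 2]mulrA mulrAC ler_pM2r ?invr_gt0//.
  apply: (@le_trans _ _ (expR (- (2 * y)) / (2 * e) / 2)); last first.
    by rewrite !ler_pM2r ?invr_gt0 ?mulr_gt0// exp_le_pow.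
  have -> : expR (- (2 * y)) / (2 * e) / 2 = expR (- (2 * y) - 1) / 4.
    by rewrite expRB -/e; field; rewrite gt_eqF.
  rewrite ler_pdivlMr//.
  have : 4 <= expR (N%:R - 2 * y - 1).
    apply: le_trans (expR_ge1Dx _).
    have : y <= N%:R / 32 by rewrite /y ler_wpM2l ?D_le ?ltW.
    by move: N16; lra.
  move=> /(ler_wpM2l (expR_ge0 (- N%:R))); rewrite -expRD => /le_trans; apply.
  by rewrite ler_expR; lra.
have short_mean : mean_run t (~~ s) <= 4 * e / D.
  rewrite /mean_run -/q -/(F (~~ s)) ler_pdivrMr; last by rewrite run_tail_gt0.
  apply: le_trans (run_tail2_le c0 t0 q0 q1 _ _) _; rewrite -/D expr1.
  apply: (@le_trans _ _ (D^-1 / D)).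
    by rewrite ler_pM2r ?invr_gt0// ler_piMl ?invr_ge0 ?ltW.
  rewrite [leRHS]mulrAC ler_pM2r ?invr_gt0//.
  apply: le_trans (_ : 4 * e * (4 * e * D)^-1 <= _).
    by rewrite invfM mulrA divff ?mul1r// gt_eqF// mulr_gt0.
  by rewrite ler_pM2l// mulr_gt0.
rewrite /symbol_freq ler_pdivrMr ?mean_cycle_gt0//.
apply: le_trans short_mean _.
apply: (@le_trans _ _ (8 * e / y * (N%:R / 2))).
  by rewrite le_eqVlt; apply/orP; left; apply/eqP; rewrite /y; field; rewrite !gt_eqF.
rewrite ler_wpM2l ?divr_ge0 ?mulr_ge0 ?(ltW e_gt0) ?(ltW y0) ?(ltW D0)//.
apply: le_trans long_mean _; rewrite /mean_cycle.
have := mean_run_gt0 true t0; have := mean_run_gt0 false t0.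
by case: (s); lra.
Qed.

End dominance.
End root.

(** * The costs *)

Section sparse_cost.
Variable R : realType.

(** Each level is the fourth power of the one before, and the first one is 16, as the dominance
    estimates require of [M] and [N]. *)
Definition level k := (2 ^ (4 ^ k.+1))%N.

Lemma levelS k : level k.+1 = (level k ^ 4)%N.
Proof. by rewrite /level -expnM -expnSr. Qed.

Lemma level_ge16 k : (16 <= level k)%N.
Proof.
by rewrite -[16%N]/(2 ^ 4)%N leq_exp2l// -{1}(expn1 4) leq_exp2l.
Qed.

Lemma leq_level : {homo level : k l / (k <= l)%N}.
Proof. by move=> k l kl; rewrite !leq_exp2l// ltnS. Qed.

Lemma ltn_level k : (k < level k)%N.
Proof.
apply: leq_ltn_trans (ltn_expl _ (ltnSn 1)).
by apply: ltnW; apply: leq_trans (ltnSn k) _; rewrite ltnW// ltn_expl.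
Qed.

Lemma sparse_level_exists (s : bool) a : exists j, (odd j == s) && (a < level j)%N.
Proof.
exists (s + a.*2)%N; rewrite oddD odd_double addbF oddb eqxx/=.
apply: leq_ltn_trans (ltn_level _); rewrite -addnn; lia.
Qed.

(* The cost of the runs of [s] only drops at every second level, at levels of
   opposite parity for the two symbols. *)
Definition sparse_cost (s : bool) a : R :=
  2 ^- level (ex_minn (sparse_level_exists s a)).

Lemma sparse_cost_gt0 s a : 0 < sparse_cost s a.
Proof. by rewrite invr_gt0 exprn_gt0. Qed.

Lemma expr2N_le m n : (m <= n)%N -> 2 ^- n <= 2 ^- m :> R.
Proof. by move=> mn; rewrite lef_pV2 ?posrE ?exprn_gt0// ler_weXn2l// ler1n. Qed.

Lemma sparse_cost_le s a : sparse_cost s a <= 2 ^- a.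
Proof.
by rewrite /sparse_cost; case: ex_minnP => j /andP[_ /ltnW aj] _; exact: expr2N_le.
Qed.

Lemma sparse_cost_ge k a : (a < level k)%N -> 2 ^- level k <= sparse_cost (odd k) a.
Proof.
rewrite /sparse_cost => ak; case: ex_minnP => j _ /(_ k).
by rewrite eqxx ak => /(_ isT) jk; apply: expr2N_le; exact: leq_level.
Qed.

Lemma sparse_cost_next k s a : (level k <= a)%N -> sparse_cost s a <= 2 ^- level k.+1.
Proof.
rewrite /sparse_cost => ka; case: ex_minnP => j /andP[_ aj] _.
apply: expr2N_le; apply: leq_level; rewrite ltnNge; apply/negP => /leq_level jk.
by have := leq_trans aj (leq_trans jk ka); rewrite ltnn.
Qed.

(** Level [k] belongs to this symbol, so the next level at which its cost drops is [k.+2]. *)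
Lemma sparse_cost_skip k a :
  (level k <= a)%N -> sparse_cost (odd k) a <= 2 ^- level k.+2.
Proof.
rewrite /sparse_cost => ka; case: ex_minnP => j /andP[/eqP oj aj] _.
apply: expr2N_le; apply: leq_level.
have kj : (k < j)%N.
  rewrite ltnNge; apply/negP => /leq_level jk.
  by have := leq_trans aj (leq_trans jk ka); rewrite ltnn.
rewrite ltn_neqAle kj andbT; apply/negP => /eqP kj1.
by move: oj; rewrite -kj1 /=; case: (odd k).
Qed.

Lemma sparse_freq_small s (eps T : R) : 0 < eps ->
  exists2 t, T < t /\ 0 < t & symbol_freq sparse_cost t s < eps.
Proof.
move=> eps0.
have cost0 u a : 0 <= sparse_cost u a := ltW (sparse_cost_gt0 u a).
have cost1 u a : sparse_cost u a <= 1.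
  by apply: le_trans (sparse_cost_le u a) _; rewrite -[leRHS]invr1 -(expr0 2) expr2N_le.
(* If [y > Y] then the bound [8 * e / y] is below [eps]; [N > B] will force this through
   [dominance_threshold]. *)
pose Y := eps^-1 * (8 * expR 1).
pose B := Num.max (3 * expR (2 * Y + 1)) T.
pose m := (Num.truncn `|B|).+1.
have Bm : B < m%:R by apply: le_lt_trans (ler_norm _) (truncnS_gt _).
(* Level [k] belongs to [s] and [k.+1] to the opposite symbol: [s] will be free from [M] on, its
   opposite only from [N] on, so [s] becomes rare. *)
pose k := (s + m.*2)%N.
have ok : odd k = s by rewrite oddD odd_double addbF oddb.
have mk : (m <= k)%N by rewrite /k -addnn; lia.
pose N := level k.+1; pose M := level k.
have N0 : 0 < N%:R :> R by rewrite ltr0n (leq_trans _ (level_ge16 _)).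
have BN : B < N%:R.
  apply: lt_le_trans Bm _; rewrite ler_nat.
  by apply: leq_trans mk _; rewrite ltnW// (leq_trans (ltnSn k))// ltnW// ltn_level.
(* At this [t] a cost [2 ^- N] amounts to [N], while a cost from the next level, [2 ^- (N ^ 4)],
   amounts to at most 1. *)
pose t : R := N%:R * 2 ^+ N.
have N_t : N%:R <= t by rewrite ler_peMr ?(ltW N0)// exprn_ege1// ler1n.
have t0 : 0 < t by exact: lt_le_trans N_t.
have Tt : T < t.
  by apply: lt_le_trans N_t; apply: le_lt_trans BN; rewrite le_max lexx orbT.
have free u : 0 <= u -> u <= 2 ^- level k.+2 -> t * u <= 1.
  move=> u0 u2; apply: (@le_trans _ _ (t * 2 ^- level k.+2)).
    by rewrite ler_wpM2l// ltW.
  rewrite ler_pdivrMr ?exprn_gt0// mul1r /t -natrX -natrM -natrX ler_nat.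
  apply: (@leq_trans (2 ^ N * 2 ^ N)); first by rewrite leq_mul2r ltnW ?orbT// ltn_expl.
  rewrite -expnD leq_exp2l// levelS -/N addnn -mul2n.
  have N2 : (2 <= N)%N by apply: leq_trans (level_ge16 _).
  by rewrite (leq_trans (leq_mul N2 (leqnn N)))// mulnn leq_exp2l.
have h1 a : (a < N)%N -> N%:R <= t * sparse_cost (~~ s) a.
  move=> aN; have := @sparse_cost_ge k.+1 a aN; rewrite [odd _]/= ok.
  move=> /(ler_wpM2l (ltW t0)); apply: le_trans.
  by rewrite /t mulfK// expf_neq0.
have h2 a : (N <= a)%N -> t * sparse_cost (~~ s) a <= 1.
  by move=> Na; apply: free => //; exact: sparse_cost_next.
have h3 a : (M <= a)%N -> t * sparse_cost (~~ ~~ s) a <= 1.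
  by move=> Ma; apply: free => //; rewrite negbK -ok; exact: sparse_cost_skip.
have MN : (M ^ 4 <= N)%N by rewrite /N levelS.
have thr := dominance_threshold cost0 cost1 (ltW t0) h1 h2 h3 (level_ge16 k) MN.
have [y0] := dominance_freq cost0 cost1 (ltW t0) h1 h2 h3 (level_ge16 k) MN.
rewrite negbK => freq_le; exists t => //; apply: le_lt_trans freq_le _.
rewrite ltr_pdivrMr// -ltr_pdivrMl//.
rewrite ltNge; apply/negP => yY; have := lt_le_trans BN thr.
rewrite ltNge le_max => /negP; apply; apply/orP; left.
by rewrite ler_pM2l// ler_expR lerD2r ler_pM2l.
Qed.

End sparse_cost.

(** * Equilibrium states *)

Section equilibrium.
Variables (R : realType) (c : bool -> nat -> R).
Hypothesis c0 : forall s a, 0 <= c s a.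
Hypothesis c2 : forall s a, c s a <= 2 ^- a.
Implicit Types (t : R) (nu mu : probability borel_cantor R).

Let phi := renewal_potential c.
Let bphi : bmeas (phi : borel_cantor -> R) := bmeas_renewal_potential c0 c2.

Let c1 s a : c s a <= 1.
Proof.
apply: le_trans (c2 s a) _; rewrite invf_le1 ?exprn_gt0// exprn_ege1//.
by rewrite ler1n.
Qed.

Let weight t := word_weight c t (pressure_root c t)
  (run_tail c t (pressure_root c t)) (run_tail2 c t (pressure_root c t)).

Let psi t (x : borel_cantor) : R := - ln (pressure_root c t) - t * phi x.

Let bpsi t : bmeas (psi t).
Proof.
apply: bmeasD; first exact: bmeas_cst.
have -> : (fun x => - (t * phi x)) = (fun x => - t * phi x).
  by apply/funext => x; rewrite mulNr.
exact: bmeasZ.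
Qed.

Let int_psi t nu :
  \int[nu]_x psi t x = - ln (pressure_root c t) - t * \int[nu]_x phi x.
Proof.
rewrite /psi; under eq_Rintegral do rewrite -mulNr.
by rewrite RintD ?Rint_cst ?RintZ ?mulNr//; [exact: bmeas_cst|exact: bmeasZ].
Qed.

Lemma int_renewal_potential_le0 nu : \int[nu]_x phi x <= 0.
Proof.
rewrite -[leRHS](Rint_cst nu 0); apply: Rint_le => //; first exact: bmeas_cst.
by move=> x; exact: renewal_potential_le0.
Qed.

Section fixed_temperature.
Variable t : R.
Hypothesis t0 : 0 <= t.
Let q := pressure_root c t.
Let q0 : 0 < q := pressure_root_gt0 c0 c1 t0.
Let q1 : q < 1 := pressure_root_lt1 c0 c1 t0.

Let tailS s a := run_tailS c0 t0 q0 q1 s a.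
Let tail2S s a := run_tail2S c0 t0 q0 q1 s a.
Let tail_gt0 s a := run_tail_gt0 c0 t0 q0 q1 s a.
Let tail2_gt0 s a := run_tail2_gt0 c0 t0 q0 q1 s a.
Let tail_log s a := proj1 (run_tail_log c0 c1 t0 q0 q1 s a).
Let tail2_log s a := proj2 (run_tail_log c0 c1 t0 q0 q1 s a).
Let tail_pressure : run_tail c t q false 0 * run_tail c t q true 0 = 1.
Proof. by have [] := pressure_rootP c0 c1 t0. Qed.

Let w_gt0 w : 0 < weight t w.
Proof. exact: word_weight_gt0. Qed.

Let w_rcons w : weight t (rcons w false) + weight t (rcons w true) = weight t w.
Proof. exact: word_weight_rcons. Qed.

Let w_cons w : weight t (false :: w) + weight t (true :: w) = weight t w.
Proof. exact: word_weight_cons. Qed.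

Let w_gibbs : exists C : R, forall (x : borel_cantor) n,
  `|- ln (weight t (mkseq x n)) - \sum_(i < n) psi t (iter i full_shift x)| <= C.
Proof.
exact (word_weight_gibbs c0 c2 t0 q0 tail_gt0 tail2_gt0 tail_log tail2_log tail_pressure).
Qed.

(** [q < 1] and [phi <= 0] make the integral of [psi] nonnegative, as [measure_entropy_le]
    demands. *)
Lemma entropy_le_pressure nu : invariant_probability nu ->
  (measure_entropy nu (full_shift : borel_cantor -> borel_cantor) <=
    (- ln q - t * \int[nu]_x phi x)%:E)%E.
Proof.
move=> inv; have [C wC] := w_gibbs; rewrite -int_psi.
apply: (measure_entropy_le w_gt0 (erefl : weight t [::] = 1) w_rcons (bpsi t) wC) => //.
rewrite int_psi; have lq : ln q <= 0 by rewrite ln_le0// ltW.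
have := mulr_ge0_le0 t0 (int_renewal_potential_le0 nu).
by lra.
Qed.

Lemma free_energy_le nu : invariant_probability nu ->
  (free_energy (fun x => (t * phi x)%R) nu <= (- ln q)%:E)%E.
Proof.
move=> inv; rewrite /free_energy RintZ//.
apply: le_trans (leeD2r _ (entropy_le_pressure inv)) _.
by rewrite -EFinD lee_fin; lra.
Qed.

(** The sign of the free energy serves [ground_state_int_eq0]; the three cylinders are all that
    [int_fixed_point_approx] needs to identify weak limits. *)
Lemma equilibrium_state_exists : exists mu,
  [/\ equilibrium_states (fun x => t * phi x) mu,
    (0 <= free_energy (fun x => (t * phi x)%R) mu)%E,
    fine (mu (cyl [:: true])) = symbol_freq c t true,
    fine (mu (cyl [:: false; true])) = (mean_cycle c t)^-1 &
    fine (mu (cyl [:: true; false])) = (mean_cycle c t)^-1].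
Proof.
have [C wC] := w_gibbs.
have [mu muE] := cyl_probability_exists (fun w => ltW (w_gt0 w)) erefl w_rcons.
have inv : invariant_probability mu := gibbs_invariant w_cons muE.
have free_ge : ((- ln q)%:E <= free_energy (fun x => (t * phi x)%R) mu)%E.
  rewrite /free_energy RintZ//.
  have := gibbs_measure_entropy w_cons (bpsi t) wC muE; rewrite int_psi.
  move=> /(leeD2r (t * \int[mu]_x phi x)%:E); apply: le_trans.
  by rewrite -EFinD lee_fin; lra.
have Z0 := mean_cycle_gt0 c0 c1 t0.
have switch s : run_tail c t q s 0 / (run_tail c t q s 0 * mean_cycle c t) = (mean_cycle c t)^-1.
  by rewrite invfM mulrA divff ?mul1r// gt_eqF.
exists mu; split.
- by split=> // nu /free_energy_le nu_le; exact: le_trans free_ge.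
- by apply: le_trans free_ge; rewrite lee_fin oppr_ge0 ln_le0// ltW.
- by rewrite muE /= /weight /= /symbol_freq /mean_run -mulrA -invfM.
- rewrite muE /weight /= -/q -[X in _ / (_ * X)]/(mean_cycle c t) switch divff ?mulr1//.
  by rewrite gt_eqF.
- rewrite muE /weight /= -/q -[X in _ / (_ * X)]/(mean_cycle c t) switch divff ?mulr1//.
  by rewrite gt_eqF.
Qed.

End fixed_temperature.

(** An equilibrium state at [t n] has nonnegative free energy, while the pressure at parameter 1
    bounds its entropy by [P1 - J], with [J] the integral of [phi]. Hence [(t n - 1) * (- J) <= P1],
    and [J] tends to 0. *)
Lemma ground_state_int_eq0 mu : ground_states phi mu -> \int[mu]_x phi x = 0.
Proof.
move=> [inv [t [mu_ [_ t_oo ES_mu cvg_mu]]]].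
have cvg_phi := cvg_mu _ (renewal_potential_continuous c0 c2).
apply/eqP; rewrite eq_le int_renewal_potential_le0/=.
apply/ler_addgt0Pr => e e0; rewrite -lerBlDr sub0r.
pose P1 := - ln (pressure_root c 1).
have P1_ge0 : 0 <= P1.
  by rewrite oppr_ge0 ln_le0// ltW// pressure_root_lt1.
apply: (cvgr_to_ge cvg_phi); have /cvgryPge/(_ (2 + P1 / e)) near_t := t_oo.
near=> n.
have tn : 2 + P1 / e <= t n by near: n.
have Pe : 0 <= P1 / e by rewrite divr_ge0// ltW.
have tn0 : 0 <= t n by lra.
have [invn maxn] := ES_mu n.
have [nu [[inv_nu _] free_ge _ _ _]] := equilibrium_state_exists tn0.
have := le_trans free_ge (maxn nu inv_nu); rewrite /free_energy RintZ//.
move=> /le_trans/(_ (leeD2r _ (entropy_le_pressure ler01 invn))).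
rewrite -EFinD lee_fin mul1r -/P1.
set J := \int[mu_ n]_x phi x => bound.
have : - J * (P1 / e + 1) <= P1.
  have J0 : J <= 0 by exact: int_renewal_potential_le0.
  have : J * (t n - 1) <= J * (P1 / e + 1) by apply: ler_wnM2l => //; lra.
  by lra.
rewrite -ler_pdivlMr; last by lra.
move=> le_J; rewrite lerNl; apply: le_trans le_J _.
rewrite ler_pdivrMr; last by lra.
by rewrite mulrDr mulrCA divff ?gt_eqF// mulr1; lra.
Unshelve. all: by end_near. Qed.

End equilibrium.

(** * Measures with rare switches are close to mixtures of the fixed points *)

Section fixed_point_mixtures.
Variable R : realType.
Implicit Types (nu : probability borel_cantor R) (g : cantor_space -> R) (s : R).

Lemma continuous_cantor_bounded g : continuous g ->
  exists2 M, 0 <= M & forall x, `|g x| <= M.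
Proof.
move=> gc; have : compact (g @` setT).
  by apply: continuous_compact; [exact: continuous_subspaceT|exact: cantor_space_compact].
move=> /compact_bounded[M [_ gM]]; exists (`|M| + 1); first by rewrite addr_ge0.
move=> x; apply: gM; last by exists x.
by rewrite ltr_pwDr// ler_norm.
Qed.

Lemma bmeas_continuous g : continuous g -> bmeas (g : borel_cantor -> R).
Proof.
move=> gc; split; first exact: continuous_measurable_cantor.
by have [M _ gM] := continuous_cantor_bounded gc; exists M.
Qed.

Definition head_choice (a b : R) (x : cantor_space) : R := if x 0%N then b else a.

Lemma bmeas_head_choice a b : bmeas (head_choice a b : borel_cantor -> R).
Proof.
exact: (@bmeas_mkseq R 1 (fun w => if head false w then b else a)).
Qed.

Lemma int_head_choice nu a b : \int[nu]_x head_choice a b x =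
  (1 - fine (nu (cyl [:: true]))) * a + fine (nu (cyl [:: true])) * b.
Proof.
have mc : measurable (cyl [:: true] : set borel_cantor) := measurable_cyl _.
have hE x : head_choice a b x = a + (b - a) * \1_(cyl [:: true]) x.
  rewrite /head_choice indicE; case: ifPn => [x0|/negbTE x0].
    by rewrite mem_set ?mulr1 ?subrKC// /cyl /mkseq /= x0.
  by rewrite memNset ?mulr0 ?addr0// /cyl /mkseq /= x0.
under eq_Rintegral do rewrite hE.
have bi : bmeas (fun x : borel_cantor => (b - a) * \1_(cyl [:: true]) x).
  by apply: bmeasZ; exact: bmeas_indic.
rewrite RintD//; last exact: bmeas_cst.
by rewrite Rint_cst RintZ ?Rint_indic//; [ring|exact: bmeas_indic].
Qed.

Lemma exists_switch (x : cantor_space) n : (exists2 i, (i < n)%N & x i != x 0%N) ->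
  exists2 i, (i < n)%N & x i != x i.+1.
Proof.
move=> [i]; elim: i => [|i IH] i_n xi; first by rewrite eqxx in xi.
have [e|e] := eqVneq (x i) (x i.+1); last by exists i => //; exact: ltnW.
by apply: IH; [exact: ltnW|rewrite e].
Qed.

(* If switches are rare then [nu] almost sees only the two fixed points. *)
Lemma int_fixed_point_approx g (e : R) : continuous g -> 0 < e ->
  exists2 K, 0 <= K & forall nu, invariant_probability nu ->
    `|\int[nu]_x g x - ((1 - fine (nu (cyl [:: true]))) * g (fun=> false)
        + fine (nu (cyl [:: true])) * g (fun=> true))|
    <= e + K * (fine (nu (cyl [:: false; true])) + fine (nu (cyl [:: true; false]))).
Proof.
move=> gc e0; have [M M0 gM] := continuous_cantor_bounded gc.
have near_fixed b : exists n, forall y, mkseq y n = nseq n b -> `|g (fun=> b) - g y| <= e.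
  have /cvgrPdist_le/(_ e e0)/cantor_nbhsP[n ny] := gc (fun=> b).
  exists n => y yn; apply: ny; rewrite yn.
  by apply: (@eq_from_nth _ true); rewrite ?size_nseq ?size_mkseq// => i i_n;
    rewrite nth_nseq nth_mkseq i_n.
have [n0 near0] := near_fixed false; have [n1 near1] := near_fixed true.
(* Without a switch in the first [n] steps a point starts with a constant word, long enough for [g]
   to be within [e] of its value at that fixed point. *)
pose n := maxn n0 n1.
pose h := head_choice (g (fun=> false)) (g (fun=> true)).
pose sw : set borel_cantor := cyl [:: false; true] `|` cyl [:: true; false].
have msw : measurable sw by apply: measurableU; exact: measurable_cyl.
have bg := bmeas_continuous gc; have bh := bmeas_head_choice (g (fun=> false)) (g (fun=> true)).
have swE (x : cantor_space) i : x i != x i.+1 -> sw (iter i full_shift x).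
  move=> xi; have : forall z : cantor_space, z 0%N != z 1%N -> sw z.
    by move=> z; rewrite /sw /cyl /mkseq /=; case: (z 0%N); case: (z 1%N) => // _; [right|left].
  by apply; rewrite !iter_shift addn0 addn1.
have pointwise (x : cantor_space) :
    `|g x - h x| <= e + \sum_(i < n) 2 * M * \1_sw (iter i full_shift x).
  have ind0 i : 0 <= 2 * M * \1_sw (iter i full_shift x) :> R.
    by rewrite mulr_ge0 ?mulr_ge0// indicE; case: (_ \in _).
  have [[i i_n xi]|no_sw] := pselect (exists2 i, (i < n)%N & x i != x i.+1).
    have : `|g x - h x| <= 2 * M.
      apply: le_trans (ler_normB _ _) _; rewrite mulr_natl mulr2n lerD//.
      by rewrite /h /head_choice; case: ifP.
    move=> /le_trans; apply; rewrite (bigD1 (Ordinal i_n))//= indicE mem_set ?mulr1; last exact: swE.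
    rewrite addrA addrAC -[leLHS]add0r lerD ?lerDr//.
      by rewrite addr_ge0 ?(ltW e0)// sumr_ge0.
  have const i : (i < n)%N -> x i = x 0%N.
    move=> i_n; apply: contrapT => /eqP xi; apply: no_sw.
    by apply: exists_switch; exists i.
  rewrite distrC; apply: (@le_trans _ _ e); last by rewrite lerDl sumr_ge0.
  rewrite /h /head_choice; case x0 : (x 0%N); [apply: near1|apply: near0];
    apply: (@eq_from_nth _ true); rewrite ?size_nseq ?size_mkseq// => i i_n;
    rewrite nth_nseq nth_mkseq i_n -?x0// const// /n leq_max i_n ?orbT//.
(* Union bound over [n] possible switches, each with an error of at most [2 * M]. *)
exists (n%:R * (2 * M)); first by rewrite mulr_ge0// mulr_ge0.
move=> nu inv; rewrite -int_head_choice -/h.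
pose S (x : borel_cantor) := e + \sum_(i < n) 2 * M * \1_sw (iter i full_shift x).
have b1 : bmeas (fun x : borel_cantor => 2 * M * \1_sw x) by apply: bmeasZ; exact: bmeas_indic.
have bsum : bmeas (fun x : borel_cantor => \sum_(i < n) 2 * M * \1_sw (iter i full_shift x)).
  by apply: bmeas_sum => i; exact: (bmeas_shift i b1).
have bS : bmeas S by apply: bmeasD => //; exact: bmeas_cst.
have intS : \int[nu]_x S x <= e + n%:R * (2 * M) *
    (fine (nu (cyl [:: false; true])) + fine (nu (cyl [:: true; false]))).
  rewrite /S RintD//; last exact: bmeas_cst.
  rewrite Rint_cst lerD2l Rint_sum => [|i]; last exact: (bmeas_shift i b1).
  rewrite (eq_bigr (fun=> 2 * M * fine (nu sw))) => [|i _]; last first.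
    by rewrite (Rint_shift i inv b1) RintZ ?Rint_indic//; exact: bmeas_indic.
  rewrite sumr_const card_ord -[leLHS]mulr_natl mulrA ler_wpM2l//.
    by rewrite mulr_ge0// mulr_ge0.
  rewrite -fineD ?fin_num_measure//; try exact: measurable_cyl.
  apply: fine_le; rewrite ?fin_numD ?fin_num_measure//; try exact: measurable_cyl.
  by apply: measureU2; exact: measurable_cyl.
have up : \int[nu]_x g x <= \int[nu]_x h x + \int[nu]_x S x.
  rewrite -RintD//; apply: Rint_le => //; first exact: bmeasD.
  by move=> x; have := pointwise x; rewrite ler_norml /S; lra.
have lo : \int[nu]_x h x <= \int[nu]_x g x + \int[nu]_x S x.
  rewrite -RintD//; apply: Rint_le => //; first exact: bmeasD.
  by move=> x; have := pointwise x; rewrite ler_norml /S; lra.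
by apply: le_trans intS; rewrite ler_norml; lra.
Qed.

End fixed_point_mixtures.

(** * Ground states *)

(** The intermediate value theorem yields frequencies in [[e, 1 - e]] only; targets nearer to 0 or 1
    are first moved into it. *)
Lemma clamp_close (R : realType) (x e : R) :
  0 <= x -> x <= 1 -> 0 < e -> e <= 4^-1 ->
  exists y, [/\ e <= y, y <= 1 - e & `|y - x| <= e].
Proof.
move=> x0 x1 e0 e4; have [xe|ex] := leP x e.
  by exists e; split=> //; rewrite ?ler_norml; lra.
have [xe1|e1x] := leP x (1 - e); last by exists (1 - e); split=> //; rewrite ?ler_norml; lra.
by exists x; split; [exact: ltW| |rewrite subrr normr0 ltW].
Qed.

Section ground_states_of_sparse_potential.
Variable R : realType.
Let c := sparse_cost R.
Let phi := renewal_potential c.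
Let c0 s a : 0 <= c s a := ltW (sparse_cost_gt0 R s a).
Let c2 s a : c s a <= 2 ^- a := sparse_cost_le R s a.

Let c1 s a : c s a <= 1.
Proof.
apply: le_trans (c2 s a) _; rewrite invf_le1 ?exprn_gt0// exprn_ege1//.
by rewrite ler1n.
Qed.

(** Between a time when the symbol 1 is rare and one when 0 is rare, both beyond [T], its frequency
    takes all intermediate values. *)
Lemma freq_attained (sigma e T : R) : 0 <= sigma -> sigma <= 1 -> 0 < e ->
  exists t, [/\ T < t, 0 < t, `|symbol_freq c t true - sigma| < e
    & (mean_cycle c t)^-1 < e].
Proof.
move=> s0 s1 e0; pose e' := Num.min e 2^-1 / 2.
have e'0 : 0 < e' by rewrite divr_gt0// lt_min e0 invr_gt0/=.
have e'e : e' < e.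
  by rewrite /e' ltr_pdivrMr// gt_min; apply/orP; left; lra.
have e'h : e' <= 4^-1.
  by rewrite /e' ler_pdivrMr// ge_min; apply/orP; right; lra.
have [T1 T1P] := mean_cycle_large c0 c1 (2 / e) (sparse_cost_gt0 R).
pose T' := Num.max T T1.
have [u [Tu u0] fu] := sparse_freq_small true T' e'0.
have [v [Tv v0] fv] := sparse_freq_small false T' e'0.
have fv1 : 1 - e' < symbol_freq c v true.
  by rewrite -(symbol_freqD c0 c1 (ltW v0)) ltrBlDr addrC ltrD2l.
pose a := Num.min u v; pose b := Num.max u v.
have ab : a <= b by rewrite ge_min !le_max lexx.
have Ta : T' < a by rewrite lt_min Tu Tv.
have a0 : 0 < a by rewrite lt_min u0 v0.
have [sigma' [sigma'_ge sigma'_le sigma'_close]] := clamp_close s0 s1 e'0 e'h.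
have cont : {within `[a, b], continuous (fun t => symbol_freq c t true)}.
  apply: continuous_in_subspaceT => t; rewrite inE/= in_itv/= => /andP[at_ _].
  by apply: symbol_freq_cvg => //; exact: lt_le_trans a0 at_.
have [|t] := IVT ab cont (v := sigma').
  have fu' : symbol_freq c u true <= sigma' := le_trans (ltW fu) sigma'_ge.
  have fv' : sigma' <= symbol_freq c v true := le_trans sigma'_le (ltW fv1).
  rewrite /a /b; case: (leP u v) => _; rewrite ge_min le_max.
    by apply/andP; split; apply/orP; [left|right].
  by apply/andP; split; apply/orP; [right|left].
rewrite in_itv/= => /andP[at_ _] ft.
have T't := lt_le_trans Ta at_; have t0 := lt_le_trans a0 at_.
exists t; split=> //.
- by apply: le_lt_trans T't; rewrite le_max lexx.
- by rewrite ft (le_lt_trans sigma'_close).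
have := T1P t; rewrite ltW ?(le_lt_trans _ T't) ?le_max ?lexx ?orbT// => /(_ isT).
rewrite ltW// => /(_ isT) Zt.
have Z0 : 0 < 2 / e by rewrite divr_gt0.
rewrite -[e]invrK ltf_pV2 ?posrE ?invr_gt0//; last exact: lt_le_trans Zt.
by apply: lt_le_trans Zt; rewrite ltr_pMl ?invr_gt0// ltr1n.
Qed.

(** Only the constant words have positive weight. *)
Lemma fixed_point_mixture (sigma : R) : 0 <= sigma -> sigma <= 1 ->
  exists mu : probability borel_cantor R, [/\ invariant_probability mu,
    fine (mu (cyl [:: true])) = sigma, fine (mu (cyl [:: false; true])) = 0 &
    fine (mu (cyl [:: true; false])) = 0].
Proof.
move=> s0 s1.
pose p w := (1 - sigma) * (all negb w)%:R + sigma * (all id w)%:R.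
have p0 w : 0 <= p w by rewrite addr_ge0// mulr_ge0// subr_ge0.
have p_nil : p [::] = 1 by rewrite /p /= !mulr1 subrK.
have p_rcons w : p (rcons w false) + p (rcons w true) = p w.
  by rewrite /p !all_rcons /=; ring.
have p_cons w : p (false :: w) + p (true :: w) = p w by rewrite /p /=; ring.
have [mu muE] := cyl_probability_exists p0 p_nil p_rcons.
exists mu; split; first exact (gibbs_invariant p_cons muE).
all: by rewrite muE /p /= ?mulr0 ?mulr1 ?addr0 ?add0r.
Qed.

Lemma ground_state_mixture (sigma : R) (mu : probability borel_cantor R) :
  0 <= sigma -> sigma <= 1 -> invariant_probability mu ->
  fine (mu (cyl [:: true])) = sigma -> fine (mu (cyl [:: false; true])) = 0 ->
  fine (mu (cyl [:: true; false])) = 0 -> ground_states phi mu.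
Proof.
move=> s0 s1 inv mu1 mu01 mu10; split=> //.
have /choice[next nextP] : forall z : R * nat, exists t, [/\ z.1 < t, 0 < t,
    `|symbol_freq c t true - sigma| < z.2.+1%:R^-1 & (mean_cycle c t)^-1 < z.2.+1%:R^-1].
  by move=> z; apply: freq_attained => //; rewrite invr_gt0.
(* Exceeding the previous value makes [t] increasing, exceeding the index sends it to infinity; the
   second component sets the accuracy [1 / (n + 1)]. *)
pose t := fix t n : R := if n is m.+1 then next (Num.max (t m) m.+1%:R, m.+1) else next (0, 0%N).
have tP n : [/\ n%:R <= t n, 0 < t n, `|symbol_freq c (t n) true - sigma| < n.+1%:R^-1
    & (mean_cycle c (t n))^-1 < n.+1%:R^-1].
  case: n => [|n] /=; first by have [_ /ltW ? ? ?] := nextP (0, 0%N); have [] := nextP (0, 0%N).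
  have [/= lt1 ? ? ?] := nextP (Num.max (t n) n.+1%:R, n.+1); split=> //.
  by apply: ltW; apply: le_lt_trans lt1; rewrite le_max lexx orbT.
have t_incr n : t n < t n.+1.
  have [/= lt1 _ _ _] := nextP (Num.max (t n) n.+1%:R, n.+1).
  by apply: le_lt_trans lt1; rewrite le_max lexx.
have /choice[mu_ mu_P] : forall n, exists nu : probability borel_cantor R,
    [/\ equilibrium_states (fun x => t n * phi x) nu,
      fine (nu (cyl [:: true])) = symbol_freq c (t n) true,
      fine (nu (cyl [:: false; true])) = (mean_cycle c (t n))^-1 &
      fine (nu (cyl [:: true; false])) = (mean_cycle c (t n))^-1].
  move=> n; have [_ tn0 _ _] := tP n.
  by have [nu [? _ ? ? ?]] := equilibrium_state_exists c0 c2 (ltW tn0); exists nu.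
exists t, mu_; split.
- by apply: homo_ltn => //; exact: lt_trans.
- apply/cvgryPge => A; near=> n.
  have [tn _ _ _] := tP n; apply: le_trans tn.
  by near: n; exact: nbhs_infty_ger.
- by move=> n; have [] := mu_P n.
move=> g gc; apply/cvgrPdist_le => e e0.
have e40 : 0 < e / 4 by rewrite divr_gt0.
have [K K0 approx] := int_fixed_point_approx gc e40.
have [ES1 f1 f01 f10] := all_and4 mu_P.
pose d := g (fun=> true) - g (fun=> false).
near=> n.
have [_ _ freq_n cyc_n] := tP n.
have [inv_n _] := ES1 n.
have := approx _ inv_n; have := approx _ inv.
rewrite mu1 mu01 mu10 f1 f01 f10 addr0 mulr0 addr0.
set S := symbol_freq c (t n) true in freq_n *; set Z := (mean_cycle c (t n))^-1 in cyc_n *.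
have KZ : K * (Z + Z) <= e / 4.
  have : K * (Z + Z) <= 2 * K * n.+1%:R^-1.
    by rewrite [2 * K]mulrC -mulrA mulr_natl mulr2n ler_wpM2l// lerD// ltW.
  move=> /le_trans; apply; rewrite ler_pdivrMr// -ler_pdivrMl//.
  by apply: le_trans (_ : n%:R <= _); [near: n; exact: nbhs_infty_ger|rewrite ler_nat].
have Sd : `|(S - sigma) * d| <= e / 4.
  rewrite normrM; apply: (@le_trans _ _ (n.+1%:R^-1 * `|d|)).
    by rewrite ler_wpM2r// ltW.
  rewrite mulrC ler_pdivrMr// -ler_pdivrMl//.
  by apply: le_trans (_ : n%:R <= _); [near: n; exact: nbhs_infty_ger|rewrite ler_nat].
by move: Sd KZ; rewrite /d !ler_norml; lra.
Unshelve. all: by end_near. Qed.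

End ground_states_of_sparse_potential.

Theorem theorem4 (R : realType) :
  exists (Phi : cantor_space -> 'rV[R]_2) (alpha : 'rV[R]_2),
    [/\ lipschitz_potential Phi, unit_circle alpha &
        exists a b : 'rV[R]_2, a != b /\
          rotation_vector Phi @` ground_states (dir_potential alpha Phi)
            = line_segment a b].
Proof.
pose c := sparse_cost R; pose phi := renewal_potential c.
have c0 s a : 0 <= c s a := ltW (sparse_cost_gt0 R s a).
have c2 s a : c s a <= 2 ^- a := sparse_cost_le R s a.
pose first_symbol := head_choice (0 : R) 1.
pose row2 (u v : R) : 'rV[R]_2 := \row_j (if j == ord0 then u else v).
pose Phi x := row2 (phi x) (first_symbol x).
have row2E u v w z : u = w -> v = z -> row2 u v = row2 w z by move=> -> ->.
(* This direction selects [phi]; the second coordinate tells its ground states apart. *)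
exists Phi, (row2 1 0); split.
- have dist0 x y : 0 <= cantor_dist R x y.
    have [<-|/(cantor_dist_first_diff R)[m -> _]] := pselect (x = y); last first.
      by rewrite invr_ge0 exprn_ge0.
    rewrite /cantor_dist; case: pselect => [e|_ //].
    by exfalso; case: e => n; rewrite eqxx.
  exists 4 => x y; rewrite /Phi.
  rewrite [leLHS]mx_normrE; apply/bigmax_leP; split=> [|[i j] _] /=.
    by rewrite mulr_ge0.
  rewrite !mxE; case: ifP => _.
    exact: (renewal_potential_lipschitz c0 c2).
  have [<-|/(cantor_dist_first_diff R)[m -> xy]] := pselect (x = y).
    by rewrite subrr normr0 mulr_ge0.
  (* First symbols differ only at distance 1, where the values are at most 1 apart. *)
  rewrite /first_symbol /head_choice; case: m xy => [_|m /(_ 0%N isT) ->].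
    rewrite expr0 invr1 mulr1; case: (x 0%N); case: (y 0%N);
      rewrite ?subrr ?subr0 ?sub0r ?normrN ?normr0 ?normr1//; lra.
  by rewrite subrr normr0 mulr_ge0// invr_ge0 exprn_ge0.
- by rewrite /unit_circle /= !big_ord_recl big_ord0 !mxE /= expr1n expr0n/= !addr0.
have dirE : dir_potential (row2 1 0) Phi = phi.
  apply/funext => x; rewrite /dir_potential !big_ord_recl big_ord0 !mxE /=.
  by rewrite mul1r mul0r !addr0.
have rvE mu : rotation_vector Phi mu = row2 (\int[mu]_x phi x) (\int[mu]_x first_symbol x).
  apply/rowP => j; rewrite !mxE; case: ifP => jE.
    by apply: eq_Rintegral => x _; rewrite mxE jE.
  by apply: eq_Rintegral => x _; rewrite mxE jE.
have int_first (mu : probability borel_cantor R) :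
    \int[mu]_x first_symbol x = fine (mu (cyl [:: true])).
  by rewrite int_head_choice mulr0 add0r mulr1.
(* The rotation vectors of the two fixed points. *)
exists (row2 0 0), (row2 0 1); split.
  apply/eqP => /rowP/(_ (lift ord0 ord0)); rewrite !mxE /= => /eqP.
  by rewrite eq_sym oner_eq0.
have segE s : (1 - s) *: row2 0 0 + s *: row2 0 1 = row2 0 s.
  by apply/rowP => j; rewrite !mxE; case: ifP => _; rewrite !(mulr0, mulr1, add0r, addr0).
rewrite dirE eqEsubset; split=> z /=.
  move=> [mu gs <-]; exists (fine (mu (cyl [:: true]))).
    rewrite /= in_itv/= fine_ge0//= -[leRHS]/(fine (1 : \bar R)) fine_le//.
    - by rewrite fin_num_measure//; exact: measurable_cyl.
    - by apply: probability_le1; exact: measurable_cyl.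
  by rewrite segE rvE int_first; apply: row2E => //; rewrite (ground_state_int_eq0 c0 c2 gs).
move=> [s]; rewrite /= in_itv/= => /andP[s0 s1] <-.
have [mu [inv mu1 mu01 mu10]] := fixed_point_mixture s0 s1.
have gs := ground_state_mixture s0 s1 inv mu1 mu01 mu10.
exists mu => //; rewrite rvE segE int_first mu1; apply: row2E => //.
exact (ground_state_int_eq0 c0 c2 gs).
Qed.
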